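(* Let $n\ge1$ and let $\iota:\prod_{i=1}^n M(\mathbb R(x_i))\to M(\mathbb R(x_1,\dots,x_n))$ be a compatible embedding. Then the image of $\iota$ is dense in $M(\mathbb R(x_1,\dots,x_n))$. Moreover, if $n>1$, then every non-empty basic open subset of $M(\mathbb R(x_1,\dots,x_n))$ contains infinitely many places that are not in the image of $\iota$.
   Context: $x_1,\dots,x_n$ are algebraically independent over $\mathbb R$. For a field $K$, $M(K)$ is the set of $\mathbb R$-places $K\to\mathbb R\cup\{\infty\}$, with topology generated by the subbasis $H'(b)=\{\zeta\in M(K)\mid \infty\ne\zeta(b)>0\}$, $b\in K$; basic open sets are finite intersections $H'(f_1)\cap\dots\cap H'(f_m)$ with $f_j$ nonzero. Let $\rho:M(\mathbb R(x_1,\dots,x_n))\to\prod_{i=1}^nM(\mathbb R(x_i))$, $\xi\mapsto(\xi|_{\mathbb R(x_1)},\dots,\xi|_{\mathbb R(x_n)})$. A compatible embedding is an injective map $\iota$ from $\prod_i M(\mathbb R(x_i))$ to $M(\mathbb R(x_1,\dots,x_n))$ with $\rho\circ\iota=\mathrm{id}$ (no continuity assumed). *)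

(* Defs.v *)
From HB Require Import structures.
From mathcomp Require Import all_boot all_order all_algebra.
From mathcomp Require Import fraction generic_quotient.
From mathcomp Require Import mpoly.
From mathcomp Require Import reals Rstruct.
From Stdlib Require Import Rdefinitions.

Set Implicit Arguments.
Unset Strict Implicit.
Unset Printing Implicit Defensive.

Import Order.TTheory GRing.Theory Num.Theory.
Local Open Scope ring_scope.

Local Notation "x %:F" := (@FracField.tofrac _ x) : ring_scope.

Notation RR := Rdefinitions.R.

Definition RatFun (n : nat) := {fraction {mpoly RR[n]}}.

(* R(t) : rational functions in one variable (a model of each R(x_i)). *)
Definition RatFun1 := {fraction {poly RR}}.

(* R-places K -> R \cup {oo}; None stands for oo.  Elementwise form of:
   phi^{-1}(R) is a valuation ring O of K containing R, phi|_O : O -> R is an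
   R-algebra homomorphism, and phi = oo exactly off O. *)
Definition is_Rplace (K : fieldType) (emb : RR -> K) (phi : K -> option RR) : Prop :=
  [/\ forall c : RR, phi (emb c) = Some c,
      forall a b u v, phi a = Some u -> phi b = Some v -> phi (a + b) = Some (u + v),
      forall a b u v, phi a = Some u -> phi b = Some v -> phi (a * b) = Some (u * v) &
      forall x, x != 0 -> (phi x = None <-> phi x^-1 = Some 0)].

Definition constN (n : nat) (c : RR) : RatFun n := (c%:MP)%:F.
Definition const1 (c : RR) : RatFun1 := (c%:P)%:F.

Definition MN (n : nat) := {phi : RatFun n -> option RR | is_Rplace (@constN n) phi}.
Definition M1 := {phi : RatFun1 -> option RR | is_Rplace const1 phi}.

(* The R-algebra embedding R(t) -> R(x_1,...,x_n), t |-> x_i, identifying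
   R(t) with the subfield R(x_i). *)
Definition poly_to_xi (n : nat) (i : 'I_n) (p : {poly RR}) : {mpoly RR[n]} :=
  (map_poly (@mpolyC n RR) p).['X_i].

Definition emb_xi (n : nat) (i : 'I_n) (r : RatFun1) : RatFun n :=
  let x := repr r in
  (poly_to_xi i (frac x).1)%:F / (poly_to_xi i (frac x).2)%:F.

Definition restr (n : nat) (i : 'I_n) (xi : MN n) : RatFun1 -> option RR :=
  fun r => sval xi (emb_xi i r).

Definition compatible_embedding (n : nat) (iota : ('I_n -> M1) -> MN n) : Prop :=
  injective iota /\
  forall (y : 'I_n -> M1) (i : 'I_n), restr i (iota y) =1 sval (y i).

Definition Hprime (n : nat) (b : RatFun n) (xi : MN n) : bool :=
  if sval xi b is Some r then 0 < r else false.

Definition in_basic (n : nat) (s : seq (RatFun n)) (xi : MN n) : bool :=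
  all (fun f => Hprime f xi) s.

(* Main.v *)
(* Let an R-place xi satisfy xi(f_j) > 0 for f_j = p_j / q_j.  The elements z with
   xi(z g^2) > 0 for some g form a preordering of R(x_1,...,x_n), which on a
   countable subfield F containing everything relevant extends, by Zorn's lemma
   inside an algebraic closure of F, to a real closed field L in which all
   p_j q_j > 0.  Eliminating one variable at a time with Sturm-Tarski root counts,
   these inequalities descend from L to a real point a (Artin-Lang).  Every place
   with x_i |-> a_i for all i, in particular one in the image of iota, then lies in
   the given basic open set.

   The image of iota contains a single place centred at a, because a place of R(t)
   is determined by a finite value at t.  Pulling image places back along
   x_1 |-> a_1 + (x_2 - a_2) x_1 gives, for every real c, a place centred at a
   sending (x_1 - a_1) / (x_2 - a_2) to c, so infinitely many are missed. *)

Require Import Defs.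
From HB Require Import structures.
From mathcomp Require Import all_boot all_order all_algebra.
From mathcomp Require Import fraction generic_quotient.
From mathcomp Require Import mpoly.
From mathcomp Require Import reals Rstruct.
From mathcomp Require Import closed_field.
From mathcomp Require Import boolp.
From mathcomp Require classical_sets.
From mathcomp Require Import polyorder polyrcf qe_rcf_th.
From mathcomp Require Import ring zify.

Set Implicit Arguments.
Unset Strict Implicit.
Unset Printing Implicit Defensive.

Import Order.TTheory GRing.Theory Num.Theory.
Local Open Scope ring_scope.

Local Notation RR := Rdefinitions.R.
Local Notation "x %:F" := (@FracField.tofrac _ x) : ring_scope.

(** * Elimination of one variable *)

Definition nonkilling (A L : nzRingType) (phi : A -> L) (C : seq A) :=
  all (fun c => phi c != 0) C.

Section Specialization.
Variable A : idomainType.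
Implicit Types (p q r : {poly A}) (C : seq A).
Import Pdiv.CommonRing.

Lemma lead_coef_special (L : idomainType) (phi : {rmorphism A -> L}) p C :
  lead_coef p \in C -> nonkilling phi C ->
  lead_coef (map_poly phi p) = phi (lead_coef p) /\
  size (map_poly phi p) = size p.
Proof.
move=> pC /allP /(_ _ pC) h.
by rewrite lead_coef_map_eq // size_map_poly_id0.
Qed.

(** Pseudo-division branches only on the sizes of the successive remainders, and a size survives
    specialization when the leading coefficient is not killed. [C] collects these leading
    coefficients. *)
Lemma redivp_rec_special q k qq r n : exists2 C : seq A, 0 \notin C &
  forall (L : idomainType) (phi : {rmorphism A -> L}),
    phi (lead_coef q) != 0 -> nonkilling phi C ->
  redivp_rec (map_poly phi q) k (map_poly phi qq) (map_poly phi r) n =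
  let t := redivp_rec q k qq r n in (t.1.1, map_poly phi t.1.2, map_poly phi t.2).
Proof.
elim: n k qq r => [|n IHn] k qq r.
  have [->|r0] := eqVneq r 0.
    exists [::] => // L phi lq _; rewrite /= rmorph0 size_map_poly_id0 // !size_poly0.
    rewrite lead_coef_map_eq // !lead_coef0 !scale0r !mul0r !subr0 !addr0.
    by case: ifP => _ /=; rewrite ?rmorph0 ?rmorphM /= ?map_polyC.
  exists [:: lead_coef r] => [|L phi lq]; first by rewrite inE eq_sym lead_coef_eq0.
  rewrite /nonkilling /= andbT => lr.
  rewrite !size_map_poly_id0 // !lead_coef_map_eq //.
  case: ifP => _ //=.
  by rewrite !rmorphD !rmorphN !rmorphM /= !map_polyZ /= !map_polyXn !map_polyC.
have [->|r0] := eqVneq r 0.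
  have [sq|sq] := ltnP 0 (size q); last first.
    exists [::] => // L phi; move: sq; rewrite leqn0 size_poly_eq0 => /eqP ->.
    by rewrite lead_coef0 rmorph0 eqxx.
  exists [::] => // L phi lq _.
  by rewrite /= rmorph0 size_map_poly_id0 // !size_poly0 sq /= rmorph0.
set r1 := r * (lead_coef q)%:P - (lead_coef r *: 'X^(size r - size q)) * q.
set qq1 := qq * (lead_coef q)%:P + (lead_coef r *: 'X^(size r - size q)).
have [C C0 HC] := IHn k.+1 qq1 r1.
exists (lead_coef r :: C) => [|L phi lq].
  by rewrite inE eq_sym lead_coef_eq0 negb_or r0.
rewrite /nonkilling /= => /andP[lr nC].
rewrite !size_map_poly_id0 // !lead_coef_map_eq //.
case: ifP => _ //=.
rewrite -[RHS](HC L phi lq nC) /r1 /qq1.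
by rewrite !rmorphD !rmorphN !rmorphM /= !map_polyZ /= !map_polyXn !map_polyC.
Qed.

(** The formula of [next_mod] over the domain [A], so that remainder sequences can be formed before
    specializing to a real closed field. *)
Definition anext_mod p q := - (lead_coef q ^+ rscalp p q) *: rmodp p q.

Lemma next_mod_special p q : exists2 C : seq A, 0 \notin C &
  forall (L : rcfType) (phi : {rmorphism A -> L}), nonkilling phi C ->
  next_mod (map_poly phi p) (map_poly phi q) = map_poly phi (anext_mod p q).
Proof.
have [->|q0] := eqVneq q 0.
  exists [::] => // L phi _.
  rewrite /anext_mod /next_mod rmorph0 /rmodp /rscalp !unlock !eqxx /=.
  by rewrite !expr0 !scaleN1r rmorphN.
have [C C0 HC] := redivp_rec_special q 0 0 p (size p).
(* [lead_coef p] is added because [size p] bounds the number of division rounds, and this bound must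
   be the same after specialization. *)
exists (lead_coef q :: C ++ (if p == 0 then [::] else [:: lead_coef p])).
  rewrite inE eq_sym lead_coef_eq0 mem_cat !negb_or q0 C0 /=.
  by case: eqVneq => // p0; rewrite inE eq_sym lead_coef_eq0.
move=> L phi; rewrite /nonkilling /= all_cat => /and3P[lq nC lp].
have sp : size (map_poly phi p) = size p.
  case: eqVneq lp => [->|p0 /=]; first by rewrite rmorph0 !size_poly0.
  by rewrite andbT => lp; rewrite size_map_poly_id0.
have q0' : map_poly phi q == 0 = false.
  by apply/negbTE; rewrite -lead_coef_eq0 lead_coef_map_eq.
rewrite /anext_mod /next_mod /rmodp /rscalp !unlock q0' (negbTE q0) sp.
have := HC _ phi lq nC; rewrite rmorph0 => -> /=.
by rewrite map_polyZ /= rmorphN rmorphXn lead_coef_map_eq.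
Qed.

(** The signed remainder sequence [ms] is formed once over [A], by induction on the size of the
    second argument. Its leading coefficients go into [C] because sign changes at infinity are read
    off from them. *)
Lemma mods_special p q : exists2 C : seq A, 0 \notin C &
  exists2 ms : seq {poly A}, {subset map lead_coef ms <= C} &
  forall (L : rcfType) (phi : {rmorphism A -> L}), nonkilling phi C ->
  mods (map_poly phi p) (map_poly phi q) = map (map_poly phi) ms.
Proof.
have [n] := ubnP (size q); elim: n => // n IHn in p q *; rewrite ltnS => sq.
have [->|p0] := eqVneq p 0.
  by exists [::] => //; exists [::] => // L phi _; rewrite rmorph0 mods0p.
have [q0|q0] := eqVneq q 0.
  exists [:: lead_coef p]; first by rewrite inE eq_sym lead_coef_eq0.
  exists [:: p] => // L phi; rewrite /nonkilling /= andbT q0 rmorph0 modsp0 => lp.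
  by rewrite -lead_coef_eq0 lead_coef_map_eq // (negbTE lp).
have [C1 C10 H1] := next_mod_special p q.
have snm : (size (anext_mod p q) < n)%N.
  apply: leq_trans sq; apply: leq_ltn_trans (size_scale_leq _ _) _.
  by rewrite ltn_rmodp.
have [C2 C20 [ms msC H2]] := IHn q (anext_mod p q) snm.
exists (lead_coef p :: C1 ++ C2).
  by rewrite inE eq_sym lead_coef_eq0 mem_cat !negb_or p0 C10 C20.
exists (p :: ms) => [c|L phi].
  rewrite /= !inE mem_cat => /orP[->//|/msC ->]; by rewrite !orbT.
rewrite /nonkilling /= all_cat => /and3P[lp n1 n2].
by rewrite neq0_mods_rec -?lead_coef_eq0 ?lead_coef_map_eq // H1 // H2.
Qed.

End Specialization.

(** Products of the members of [sq] with exponents 1 or 2. Since [sgz y + sgz y ^+ 2] is 2 for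
    positive [y] and 0 otherwise, the sum of the signs of these products detects simultaneous
    positivity. *)
Fixpoint sign_combs (A : nzRingType) (sq : seq {poly A}) : seq {poly A} :=
  if sq is q :: sq' then
    map ( *%R q) (sign_combs sq') ++ map ( *%R (q ^+ 2)) (sign_combs sq')
  else [:: 1].

Lemma map_sign_combs (A B : nzRingType) (phi : {rmorphism A -> B}) sq :
  sign_combs (map (map_poly phi) sq) = map (map_poly phi) (sign_combs sq).
Proof.
elim: sq => [|q sq IH] /=; first by rewrite rmorph1.
rewrite IH map_cat -!map_comp; congr (_ ++ _); apply: eq_map => r /=;
  by rewrite ?rmorphM ?rmorphXn.
Qed.

Section TarskiCount.
Variable L : rcfType.
Implicit Types (p : {poly L}) (sq : seq {poly L}).

Lemma sum_sgz_combs sq (x : L) :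
  \sum_(r <- sign_combs sq) sgz r.[x] = 2 ^+ size sq * (all (fun q => 0 < q.[x]) sq)%:R.
Proof.
elim: sq => [|q sq IH] /=; first by rewrite big_seq1 hornerC sgz1 expr0 mulr1.
rewrite big_cat !big_map /=.
under eq_bigr do rewrite hornerM sgzM.
under [X in _ + X]eq_bigr do rewrite hornerM sgzM.
rewrite -!mulr_sumr IH -mulrDl horner_exp sgzX.
have [xq|xq|xq] := sgzP (q.[x]); rewrite /= ?mulr0 ?mul0r ?addr0 ?mulr0 //.
by rewrite expr1n mulrA exprS.
Qed.

(** After exchanging sums, a root of [p] contributes [2 ^+ size sq] if all of [sq] is positive there
    and nothing otherwise. *)
Lemma sum_taqR_combs p sq :
  (0 < \sum_(r <- sign_combs sq) taqR p r) =
  has (fun x => all (fun q => 0 < q.[x]) sq) (rootsR p).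
Proof.
under eq_bigr do rewrite -taq_taqR /taq.
rewrite exchange_big /=.
under eq_bigr do rewrite sum_sgz_combs.
rewrite -mulr_sumr pmulr_rgt0 ?exprn_gt0 //.
elim: (rootsR p) => [|x s IH] /=; first by rewrite big_nil ltxx.
rewrite big_cons; case: (all _ sq) => /=; last by rewrite add0r IH.
by rewrite ltr_wpDr // sumr_ge0.
Qed.

End TarskiCount.

Definition same_signs (A : nzRingType) (L1 L2 : rcfType)
    (phi1 : A -> L1) (phi2 : A -> L2) (C : seq A) :=
  all (fun c => sgz (phi1 c) == sgz (phi2 c)) C.

Lemma same_signs_changes (A : nzRingType) (L1 L2 : rcfType)
    (phi1 : {rmorphism A -> L1}) (phi2 : {rmorphism A -> L2}) (C : seq A) :
  same_signs phi1 phi2 C -> changes (map phi1 C) = changes (map phi2 C).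
Proof.
elim: C => [//|c [|d C] IH] /= /andP[/eqP cE dC]; first by rewrite !mulr0 !ltxx.
have /eqP dE := proj1 (andP dC).
congr (_ + _)%N; last exact: IH.
by rewrite -!sgz_cp0 !sgzM cE dE.
Qed.

Section Transfer.
Variables (A : idomainType) (L1 L2 : rcfType).
Variables (phi1 : {rmorphism A -> L1}) (phi2 : {rmorphism A -> L2}).
Variable C : seq A.
Hypotheses (C1 : nonkilling phi1 C) (C2 : nonkilling phi2 C).
Hypothesis C12 : same_signs phi1 phi2 C.

(** Sign changes at the two infinities depend only on the signs of leading coefficients and the
    parities of sizes, and the conditions on [C] fix both. *)
Lemma changes_poly_special (ms : seq {poly A}) :
  {subset map lead_coef ms <= C} ->
  changes_poly (map (map_poly phi1) ms) = changes_poly (map (map_poly phi2) ms).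
Proof.
move=> msC.
have lc p : p \in ms -> lead_coef p \in C by move=> h; apply/msC/map_f.
have ss f (h : forall p, p \in ms -> f p \in C \/ - f p \in C) :
    same_signs phi1 phi2 (map f ms).
  apply/allP => _ /mapP[p /h [] pC ->]; move/allP/(_ _ pC): C12 => //.
  by rewrite !rmorphN !sgzN => /eqP/oppr_inj ->.
rewrite /changes_poly /changes_minfty /changes_pinfty -!map_comp.
congr (_%:Z - _%:Z).
  transitivity (changes (map phi1
      [seq (-1) ^+ (~~ odd (size p)) * lead_coef p | p : {poly A} <- ms])).
    rewrite -map_comp; congr changes; apply/eq_in_map => p /lc pC /=.
    have [-> ->] := lead_coef_special pC C1.
    by rewrite rmorphM rmorphXn rmorphN rmorph1.
  rewrite (same_signs_changes (phi2 := phi2)); last first.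
    apply: ss => p /lc; case: odd; rewrite /= ?expr0 ?mul1r ?mulN1r ?opprK; tauto.
  rewrite -map_comp; congr changes; apply/eq_in_map => p /lc pC /=.
  have [-> ->] := lead_coef_special pC C2.
  by rewrite rmorphM rmorphXn rmorphN rmorph1.
transitivity (changes (map phi1 (map lead_coef ms))).
  rewrite -map_comp; congr changes; apply/eq_in_map => p /lc pC /=.
  by have [-> _] := lead_coef_special pC C1.
rewrite (same_signs_changes (phi2 := phi2)); last by apply: ss => p /lc; left.
rewrite -map_comp; congr changes; apply/eq_in_map => p /lc pC /=.
by have [-> _] := lead_coef_special pC C2.
Qed.

End Transfer.

Lemma taqR_special (A : idomainType) (p q : {poly A}) :
  exists2 C : seq A, 0 \notin C &
  forall (L1 L2 : rcfType)
    (phi1 : {rmorphism A -> L1}) (phi2 : {rmorphism A -> L2}),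
    nonkilling phi1 C -> nonkilling phi2 C -> same_signs phi1 phi2 C ->
    taqR (map_poly phi1 p) (map_poly phi1 q) =
    taqR (map_poly phi2 p) (map_poly phi2 q).
Proof.
have [C C0 [ms msC HC]] := mods_special p (p^`() * q).
exists C => // L1 L2 phi1 phi2 n1 n2 ss.
rewrite /taqR /changes_mods !deriv_map -!rmorphM !HC //.
exact: changes_poly_special n1 n2 ss _ msC.
Qed.

Lemma sum_taqR_special (A : idomainType) (p : {poly A}) (s : seq {poly A}) :
  exists2 C : seq A, 0 \notin C &
  forall (L1 L2 : rcfType)
    (phi1 : {rmorphism A -> L1}) (phi2 : {rmorphism A -> L2}),
    nonkilling phi1 C -> nonkilling phi2 C -> same_signs phi1 phi2 C ->
    \sum_(r <- s) taqR (map_poly phi1 p) (map_poly phi1 r) =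
    \sum_(r <- s) taqR (map_poly phi2 p) (map_poly phi2 r).
Proof.
elim: s => [|q s [C C0 IH]].
  by exists [::] => // L1 L2 phi1 phi2 _ _ _; rewrite !big_nil.
have [D D0 HD] := taqR_special p q.
exists (D ++ C); first by rewrite mem_cat negb_or D0.
move=> L1 L2 phi1 phi2; rewrite /nonkilling /same_signs !all_cat.
move=> /andP[d1 c1] /andP[d2 c2] /andP[d12 c12].
by rewrite !big_cons (HD _ _ phi1 phi2) // (IH _ _ phi1 phi2).
Qed.

(** A solvable system has a solution near one of the infinities, where leading coefficients decide,
    or at a root of the derivative [b] of the product (Rolle), where a sum of Tarski queries
    decides. [C] holds the elements of [A] whose signs determine these tests. *)
Lemma elim_pos (A : idomainType) (sq : seq {poly A}) :
  0 \notin sq ->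
  exists2 C : seq A, 0 \notin C &
  forall (L1 L2 : rcfType)
    (phi1 : {rmorphism A -> L1}) (phi2 : {rmorphism A -> L2}),
    nonkilling phi1 C -> nonkilling phi2 C -> same_signs phi1 phi2 C ->
    (exists x, all (fun q => 0 < (map_poly phi1 q).[x]) sq) ->
    exists x, all (fun q => 0 < (map_poly phi2 q).[x]) sq.
Proof.
move=> sq0; pose b : {poly A} := (\prod_(q <- sq) q)^`().
have [D D0 HD] := sum_taqR_special b (sign_combs sq).
exists (D ++ map lead_coef sq ++ (if b == 0 then [::] else [:: lead_coef b])).
  rewrite !mem_cat !negb_or D0; apply/andP; split=> //; apply/andP; split.
    apply: contra sq0 => /mapP[q qs] /esym/eqP.
    by rewrite lead_coef_eq0 => /eqP<-.
  by case: eqVneq => // b0; rewrite inE eq_sym lead_coef_eq0.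
move=> L1 L2 phi1 phi2; rewrite /nonkilling /same_signs !all_cat.
move=> /and3P[d1 l1 b1] /and3P[d2 l2 b2] /and3P[d12 l12 b12] ex1.
have lq1 q : q \in sq -> lead_coef (map_poly phi1 q) = phi1 (lead_coef q) /\
    size (map_poly phi1 q) = size q.
  by move=> h; apply: lead_coef_special l1; apply: map_f.
have lq2 q : q \in sq -> lead_coef (map_poly phi2 q) = phi2 (lead_coef q) /\
    size (map_poly phi2 q) = size q.
  by move=> h; apply: lead_coef_special l2; apply: map_f.
have lqs q : q \in sq -> sgz (phi1 (lead_coef q)) = sgz (phi2 (lead_coef q)).
  by move=> h; apply/eqP/(allP l12)/map_f.
have bE (L : rcfType) (phi : {rmorphism A -> L}) :
    bounding_poly (map (map_poly phi) sq) = map_poly phi b.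
  by rewrite /bounding_poly big_map -deriv_map rmorph_prod.
have allE (L : rcfType) (phi : {rmorphism A -> L}) (P : pred {poly L}) :
    \big[andb/true]_(q <- map (map_poly phi) sq) P q =
    all (fun q => P (map_poly phi q)) sq.
  by rewrite big_map big_all.
suff [x hx] : exists x : L2,
    \big[andb/true]_(q <- map (map_poly phi2) sq) (0 < q.[x]).
  by exists x; rewrite -(allE L2 phi2 (fun q => 0 < q.[x])).
apply/bounding_polyP.
have {ex1} /bounding_polyP : exists x : L1,
    \big[andb/true]_(q <- map (map_poly phi1) sq) (0 < q.[x]).
  by case: ex1 => x hx; exists x; rewrite (allE L1 phi1 (fun q => 0 < q.[x])).
have case1 : all (fun q => 0 < lead_coef (map_poly phi1 q)) sq ->
    all (fun q => 0 < lead_coef (map_poly phi2 q)) sq.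
  move=> /allP h; apply/allP => q qs; move: (h q qs).
  by rewrite (lq1 q qs).1 (lq2 q qs).1 -!sgz_cp0 lqs.
case=> [h|h|[x]].
- constructor 1; rewrite (allE L2 phi2 (fun q => 0 < lead_coef q)).
  by apply: case1; rewrite -(allE L1 phi1 (fun q => 0 < lead_coef q)).
- constructor 2; move: h.
  rewrite (allE L1 phi1 (fun q => 0 < (-1) ^+ (size q).-1 * lead_coef q)).
  rewrite (allE L2 phi2 (fun q => 0 < (-1) ^+ (size q).-1 * lead_coef q)).
  move=> /allP h; apply/allP => q qs; move: (h q qs).
  rewrite (lq1 q qs).1 (lq2 q qs).1 (lq1 q qs).2 (lq2 q qs).2.
  by rewrite -!sgz_cp0 !sgzM !sgzX !sgzN !sgz1 lqs.
rewrite bE => /andP[rx]; rewrite (allE L1 phi1 (fun q => 0 < q.[x])) => hx.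
(* If [b] vanishes, all of [sq] specializes to constants under [phi1], so the values at [x] are the
   leading coefficients. *)
have [b0|b0] := eqVneq b 0.
  constructor 1; rewrite (allE L2 phi2 (fun q => 0 < lead_coef q)); apply: case1.
  have /eqP : size (map_poly phi1 (\prod_(q <- sq) q))^`() = 0%N.
    by rewrite deriv_map -/b b0 rmorph0 size_poly0.
  rewrite size_deriv rmorph_prod -subn1 subn_eq0 => s1.
  have : size (\prod_(q <- map (map_poly phi1) sq) q) == 1%N.
    rewrite big_map eqn_leq s1 lt0n size_poly_eq0 prodf_seq_neq0.
    apply/allP => q qs; rewrite -lead_coef_eq0 (lq1 q qs).1.
    by apply: (allP l1); apply: map_f.
  move/size_prod_eq1 => sz; apply/allP => q qs.
  have := allP hx q qs; have /eqP/size_poly1P[c _ ->] := sz _ (map_f _ qs).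
  by rewrite hornerC lead_coefC.
constructor 3.
move: b1 b2; rewrite (negbTE b0) /= !andbT => b1 b2.
have b10 : map_poly phi1 b != 0 by rewrite -lead_coef_eq0 lead_coef_map_eq.
have b20 : map_poly phi2 b != 0 by rewrite -lead_coef_eq0 lead_coef_map_eq.
have : 0 < \sum_(r <- sign_combs (map (map_poly phi1) sq)) taqR (map_poly phi1 b) r.
  rewrite sum_taqR_combs; apply/hasP; exists x; last by rewrite all_map.
  by rewrite -roots_on_rootsR ?b10 //.
rewrite map_sign_combs big_map (HD _ _ phi1 phi2) // -(big_map (map_poly phi2) predT (taqR _)).
rewrite -map_sign_combs sum_taqR_combs => /hasP[y ry hy].
exists y; rewrite bE; apply/andP; split; last by rewrite big_all.
by rewrite -[_ == 0]/(root _ y) [root _ _]roots_on_rootsR.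
Qed.

(** * Maximal preorderings and real closed fields *)

Definition subfield_closed (K : fieldType) (S : K -> Prop) :=
  [/\ S 1, forall x y, S x -> S y -> S (x - y) &
     forall x y, S x -> S y -> S (x / y)].

(* The closure proof is an argument so that the canonical structures below can
   be keyed on [subfield_pred]. *)
Definition subfield_pred (K : fieldType) (S : K -> Prop)
  (_ : subfield_closed S) : {pred K} := fun x => `[< S x >].

Section Subfield.
Variables (K : fieldType) (S : K -> Prop) (S_closed : subfield_closed S).
Local Notation P := (subfield_pred S_closed).

Fact subfield_pred_closed : divring_closed P.
Proof.
case: S_closed => S1 SB SV; split; first exact/asboolP.
  by move=> x y /asboolP Sx /asboolP Sy; apply/asboolP/SB.
by move=> x y /asboolP Sx /asboolP Sy; apply/asboolP/SV.
Qed.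
HB.instance Definition _ := GRing.isDivringClosed.Build K P subfield_pred_closed.

Definition subfield : Type := {x : K | x \in P}.
HB.instance Definition _ := [isSub for (fun u : subfield => sval u)].
HB.instance Definition _ := [Choice of subfield by <:].
HB.instance Definition _ := [SubChoice_isSubIntegralDomain of subfield by <:].
HB.instance Definition _ := [SubIntegralDomain_isSubField of subfield by <:].

Lemma subfieldP (x : subfield) : S (\val x).
Proof. by apply/asboolP; case: x. Qed.

Definition to_subfield (x : K) (Sx : S x) : subfield := exist _ x (asboolT Sx).

End Subfield.

(** A preordering of the field of differences of [Q] inside [C]. Only squares of differences are
    demanded, because in an algebraically closed [C] the element -1 is itself a square. *)
Record preordered (C : fieldType) (Q : C -> Prop) : Prop := Preordered {
  preord1 : Q 1;
  preordD : forall x y, Q x -> Q y -> Q (x + y);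
  preordM : forall x y, Q x -> Q y -> Q (x * y);
  preordV : forall x, Q x -> Q x^-1;
  preord_sqrB : forall x y, Q x -> Q y -> Q ((x - y) ^+ 2);
  preordN1 : ~ Q (-1) }.

(** The competitors [Q'] range over all of [C] and may generate larger fields; this is what later
    forces real closedness. *)
Definition maximal_preordered (C : fieldType) (Q : C -> Prop) :=
  preordered Q /\
  forall Q' : C -> Prop, preordered Q' -> (forall x, Q x -> Q' x) ->
    forall x, Q' x -> Q x.

Definition differences (C : fieldType) (Q : C -> Prop) (x : C) :=
  exists a b, [/\ Q a, Q b & x = a - b].

Section Differences.
Variables (C : fieldType) (Q : C -> Prop).
Hypothesis Qpre : preordered Q.
Local Notation E := (differences Q).

Lemma preord0 : Q 0.
Proof.
have := preord_sqrB Qpre (preord1 Qpre) (preord1 Qpre).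
by rewrite subrr expr0n.
Qed.

Lemma preord_sqr x : E x -> Q (x ^+ 2).
Proof. by case=> a [b [Qa Qb ->]]; apply: preord_sqrB. Qed.

Lemma sub_differences x : Q x -> E x.
Proof. by move=> Qx; exists x, 0; split; rewrite ?subr0 //; apply: preord0. Qed.

Lemma differencesM x y : E x -> E y -> E (x * y).
Proof.
case=> a [b [Qa Qb ->]] [c [d [Qc Qd ->]]].
exists (a * c + b * d), (a * d + b * c); split; last by ring.
  by apply: (preordD Qpre); apply: (preordM Qpre).
by apply: (preordD Qpre); apply: (preordM Qpre).
Qed.

Lemma differencesV x : E x -> E x^-1.
Proof.
move=> Ex; have [->|x0] := eqVneq x 0.
  by rewrite invr0; apply/sub_differences/preord0.
rewrite (_ : x^-1 = x * (x ^+ 2)^-1); last by field.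
by apply: differencesM => //; apply/sub_differences/(preordV Qpre)/preord_sqr.
Qed.

Lemma differencesB x y : E x -> E y -> E (x - y).
Proof.
case=> a [b [Qa Qb ->]] [c [d [Qc Qd ->]]].
by exists (a + d), (b + c); split; [apply: (preordD Qpre)|apply: (preordD Qpre)|ring].
Qed.

Lemma differences_closed : subfield_closed E.
Proof.
split; first exact: sub_differences (preord1 Qpre).
  exact: differencesB.
by move=> x y Ex Ey; apply: differencesM => //; apply: differencesV.
Qed.

Lemma preord_antisym x : Q x -> Q (- x) -> x = 0.
Proof.
move=> Qx Qnx; apply/eqP/negP => /negP x0; apply: (preordN1 Qpre).
rewrite (_ : -1 = - x * x^-1); last by rewrite mulNr divff.
by apply: (preordM Qpre) => //; apply: (preordV Qpre).
Qed.

End Differences.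

Section MaximalPreorder.
Variables (C : fieldType) (Q : C -> Prop).
Hypothesis Qmax : maximal_preordered Q.
Local Notation Qpre := (proj1 Qmax).
Local Notation E := (differences Q).

(* If [-z] is not in [Q] then [Q + zQ] is again a preordering of the same field. *)
Lemma preord_total z : E z -> Q z \/ Q (- z).
Proof.
move=> Ez; have [Qz|nQnz] := pselect (Q (- z)); [by right|left].
pose Q' x := exists a b, [/\ Q a, Q b & x = a + z * b].
have QQ' x : Q x -> Q' x.
  by move=> Qx; exists x, 0; split => //; [apply: (preord0 Qpre)|rewrite mulr0 addr0].
have Q'E x : Q' x -> E x.
  case=> a [b [Qa Qb ->]]; rewrite (_ : a + z * b = a - (0 - z) * b); last by ring.
  apply: (differencesB Qpre); first exact: (sub_differences Qpre).
  apply: (differencesM Qpre); last exact: (sub_differences Qpre).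
  by apply: (differencesB Qpre) => //; apply/(sub_differences Qpre)/(preord0 Qpre).
apply: (Qmax.2 Q') => //; last first.
  by exists 0, 1; split; [apply: (preord0 Qpre)|apply: (preord1 Qpre)|ring].
have Q'M x y : Q' x -> Q' y -> Q' (x * y).
  case=> a [b [Qa Qb ->]] [c [d [Qc Qd ->]]].
  exists (a * c + z ^+ 2 * (b * d)), (a * d + b * c); split; last by ring.
    apply: (preordD Qpre); first exact: (preordM Qpre).
    by apply: (preordM Qpre); [apply: (preord_sqr Qpre)|apply: (preordM Qpre)].
  by apply: (preordD Qpre); apply: (preordM Qpre).
split => //.
- exact/QQ'/(preord1 Qpre).
- move=> x y [a [b [Qa Qb ->]]] [c [d [Qc Qd ->]]].
  by exists (a + c), (b + d); split; [apply: (preordD Qpre)|apply: (preordD Qpre)|ring].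
- move=> x Q'x; have [->|x0] := eqVneq x 0; first by rewrite invr0; apply/QQ'/(preord0 Qpre).
  rewrite (_ : x^-1 = x * (x ^+ 2)^-1); last by field.
  by apply: Q'M => //; apply/QQ'/(preordV Qpre)/(preord_sqr Qpre) => //; apply: Q'E.
- by move=> x y /Q'E Ex /Q'E Ey; apply/QQ'/(preord_sqr Qpre) => //; apply: (differencesB Qpre).
(* If [-1 = a + z * b] with [b] nonzero, then [- z = (1 + a) / b] lies in [Q], against the
   assumption on [z]. *)
- case=> a [b [Qa Qb e]]; have [b0|b0] := eqVneq b 0.
    by apply: (preordN1 Qpre); rewrite e b0 mulr0 addr0.
  apply: nQnz; rewrite (_ : - z = (1 + a) * b^-1).
    apply: (preordM Qpre); last exact: (preordV Qpre).
    by apply: (preordD Qpre) => //; apply: (preord1 Qpre).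
  apply: (mulIf b0); rewrite mulfVK //.
  by rewrite mulNr -[z * b](addKr a) -e; ring.
Qed.

Definition preord_field : Type := subfield (differences_closed Qpre).
HB.instance Definition _ := GRing.Field.on preord_field.
Local Notation L := preord_field.

Definition preord_val (x : L) : C := \val (x : subfield (differences_closed Qpre)).
Local Notation v := preord_val.

Fact preord_val_zmod : zmod_morphism v. Proof. by []. Qed.
Fact preord_val_monoid : monoid_morphism v. Proof. by []. Qed.
HB.instance Definition _ := GRing.isZmodMorphism.Build L C v preord_val_zmod.
HB.instance Definition _ := GRing.isMonoidMorphism.Build L C v preord_val_monoid.

Let le (x y : L) := `[< Q (v y - v x) >].
Let norm (x : L) := if le 0 x then x else - x.

Fact preord_le0_add x y : le 0 x -> le 0 y -> le 0 (x + y).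
Proof.
move=> /asboolP; rewrite (rmorph0 v) subr0 => Qx /asboolP; rewrite (rmorph0 v) subr0 => Qy.
by apply/asboolP; rewrite (rmorph0 v) subr0 (rmorphD v); apply: (preordD Qpre).
Qed.

Fact preord_le0_mul x y : le 0 x -> le 0 y -> le 0 (x * y).
Proof.
move=> /asboolP; rewrite (rmorph0 v) subr0 => Qx /asboolP; rewrite (rmorph0 v) subr0 => Qy.
by apply/asboolP; rewrite (rmorph0 v) subr0 (rmorphM v); apply: (preordM Qpre).
Qed.

Fact preord_le0_anti x : le 0 x -> le x 0 -> x = 0.
Proof.
move=> /asboolP; rewrite (rmorph0 v) subr0 => Qx /asboolP; rewrite (rmorph0 v) sub0r => Qy.
by apply: (fmorph_inj v); rewrite (rmorph0 v); exact: (preord_antisym Qpre Qx Qy).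
Qed.

Fact preord_sub_ge0 x y : le 0 (y - x) = le x y.
Proof. by rewrite /le (rmorph0 v) subr0 (rmorphB v). Qed.

Fact preord_le0_total x : le 0 x || le x 0.
Proof.
rewrite /le (rmorph0 v) subr0 sub0r; apply/orP.
by case: (preord_total (subfieldP (x : subfield _))) => h; [left|right]; apply/asboolP.
Qed.

Fact preord_normN x : norm (- x) = norm x.
Proof.
rewrite /norm /le (rmorph0 v) !subr0 (rmorphN v) opprK.
case: (asboolP (Q (- v x))) => h; case: (asboolP (Q (v x))) => h' //.
  have /eqP := preord_antisym Qpre h' h; rewrite fmorph_eq0 => /eqP->.
  by rewrite oppr0.
by case: (preord_total (subfieldP (x : subfield _))).
Qed.

Fact preord_ge0_norm x : le 0 x -> norm x = x.
Proof. by rewrite /norm => ->. Qed.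

HB.instance Definition _ := Num.IntegralDomain_isLeReal.Build L
  preord_le0_add preord_le0_mul preord_le0_anti preord_sub_ge0
  preord_le0_total preord_normN preord_ge0_norm (fun _ _ => erefl).

Lemma preord_field_ge0 (x : L) : (0 <= x) <-> Q (v x).
Proof.
by split => [/asboolP|h]; [|apply/asboolP]; rewrite (rmorph0 v) subr0.
Qed.

End MaximalPreorder.

(** * Weighted sums of squares and real closedness *)

Section WeightedSquares.
Variable L : realFieldType.
Implicit Types p q s t : {poly L}.

(** Evaluated at an algebraic element [alpha], these polynomials give the cone generated by the
    nonnegative elements of [L] and the squares of [L(alpha)]. *)
Inductive weighted_sos : {poly L} -> Prop :=
| WSos0 : weighted_sos 0
| WSosS c q s : 0 <= c -> weighted_sos s -> weighted_sos (c *: q ^+ 2 + s).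

Lemma weighted_sos1 c q : 0 <= c -> weighted_sos (c *: q ^+ 2).
Proof. by move=> c0; rewrite -[_ *: _]addr0; apply: WSosS => //; apply: WSos0. Qed.

Lemma weighted_sosD s t : weighted_sos s -> weighted_sos t -> weighted_sos (s + t).
Proof.
move=> hs ht; elim: hs => [|c q {}s c0 _ IH]; first by rewrite add0r.
by rewrite -addrA; apply: WSosS.
Qed.

Lemma weighted_sosM s t : weighted_sos s -> weighted_sos t -> weighted_sos (s * t).
Proof.
move=> hs ht; elim: hs => [|c q {}s c0 _ IH]; first by rewrite mul0r; apply: WSos0.
rewrite mulrDl; apply: weighted_sosD => // {IH}.
elim: ht => [|d r {}t d0 _ IH]; first by rewrite mulr0; apply: WSos0.
rewrite mulrDr; apply: weighted_sosD => //.
by rewrite -scalerAl -scalerAr scalerA -exprMn; apply/weighted_sos1/mulr_ge0.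
Qed.

Lemma weighted_sos_ge0 s x : weighted_sos s -> 0 <= s.[x].
Proof.
elim=> [|c q {}s c0 _ IH]; first by rewrite horner0.
by rewrite hornerD hornerZ horner_exp addr_ge0 // mulr_ge0 // sqr_ge0.
Qed.

(** Each [q] is replaced by its remainder modulo [p]. The bound keeps the degree of [t] below twice
    that of [p], so that the cofactor of [p] in [1 + t] has smaller degree than [p]. *)
Lemma weighted_sos_mod p s : (1 < size p)%N -> weighted_sos s ->
  exists t, [/\ weighted_sos t, p %| s - t & (size t < (size p).-1.*2)%N].
Proof.
move=> p1; elim=> [|c q {}s c0 _ [t [ht ps st]]].
  exists 0; split; rewrite ?subr0 ?dvdp0 ?size_poly0 //; first exact: WSos0.
  by case: (size p) p1 => [|[|]].
have p0 : p != 0 by rewrite -size_poly_gt0 (ltn_trans _ p1).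
exists (c *: (q %% p) ^+ 2 + t); split.
- exact: WSosS.
- rewrite opprD addrACA; apply: dvdp_add => //; rewrite -scalerBr.
  rewrite -mul_polyC dvdp_mull //.
  by rewrite subr_sqr {1}(divp_eq q p) addrK dvdp_mulr // dvdp_mull.
- apply: leq_ltn_trans (size_polyD _ _) _; rewrite gtn_max st andbT.
  apply: leq_ltn_trans (size_scale_leq _ _) _.
  have sr : (size (q %% p)%R < size p)%N by rewrite ltn_modp.
  have [->|r0] := eqVneq (q %% p) 0.
    by rewrite expr0n size_poly0; case: (size p) p1 => [|[|]].
  by rewrite expr2 size_mul // -addnn; move: sr p1; move: (size _) (size _) => k m; lia.
Qed.

End WeightedSquares.

Section RealClosed.
Variables (C : closedFieldType) (L : realFieldType) (v : {rmorphism L -> C}).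

Section RootAdjunction.
Variables (p : {poly L}) (alpha : C).
Hypothesis p_irr : irreducible_poly p.
Hypothesis p_alpha : root (map_poly v p) alpha.
Local Notation ev q := ((map_poly v q).[alpha]).

Lemma ev_eq0 q : (ev q == 0) = (p %| q).
Proof.
apply/idP/idP => [/eqP q0|/dvdpP[r ->]]; last first.
  by rewrite rmorphM hornerM (eqP p_alpha) mulr0.
apply/negP => /negP; rewrite -irreducible_poly_coprime //.
move=> /Bezout_eq1_coprimepP[[u w] /= /(congr1 (fun r => ev r))].
rewrite rmorphD !rmorphM !hornerD !hornerM (eqP p_alpha) q0 !mulr0 addr0 rmorph1 hornerC.
by move/esym/eqP; rewrite oner_eq0.
Qed.

Lemma ev_inv q : exists r, ev r = (ev q)^-1.
Proof.
have [pq|] := boolP (p %| q).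
  by exists 0; rewrite rmorph0 horner0 (eqP (etrans (ev_eq0 q) pq)) invr0.
rewrite -irreducible_poly_coprime //.
move=> /Bezout_eq1_coprimepP[[u w] /= /(congr1 (fun r => ev r))].
rewrite rmorphD !rmorphM !hornerD !hornerM (eqP p_alpha) !mulr0 add0r rmorph1 hornerC.
move=> e; exists w; have q0 : ev q != 0.
  by apply: contra_eq_neq e => ->; rewrite mulr0 eq_sym oner_eq0.
by apply: (mulIf q0); rewrite e mulVf.
Qed.

Variable Q : C -> Prop.
Hypothesis Qmax : maximal_preordered Q.
Hypothesis vQ : forall x, 0 <= x <-> Q (v x).
Hypothesis v_onto : forall z, differences Q z -> exists x, v x = z.

Let Q' (z : C) := exists2 s, weighted_sos s & z = ev s.

(** The hypothesis says that -1 is not in [Q'], so [Q'] is a preordering containing [Q]. By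
    maximality it adds nothing, hence [alpha] already comes from [L]. *)
Lemma root_of_maximal :
  (forall s, weighted_sos s -> ~~ (p %| 1 + s)) -> exists x : L, root p x.
Proof.
move=> nsos.
have Q'sq q : Q' (ev q ^+ 2).
  exists (q ^+ 2); last by rewrite rmorphXn horner_exp.
  by rewrite -[q ^+ 2]scale1r; apply/weighted_sos1/ler01.
have Q'M x y : Q' x -> Q' y -> Q' (x * y).
  case=> s hs -> [t ht ->]; exists (s * t); last by rewrite rmorphM hornerM.
  exact: weighted_sosM.
have Q'pre : preordered Q'.
  split => //.
  - by have := Q'sq 1; rewrite rmorph1 hornerC expr1n.
  - move=> x y [s hs ->] [t ht ->]; exists (s + t); last by rewrite rmorphD hornerD.
    exact: weighted_sosD.
  - move=> x Q'x; have [s _ xs] := Q'x; have [r rE] := ev_inv s.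
    have [->|x0] := eqVneq x 0.
      by rewrite invr0; exists 0; [apply: WSos0|rewrite rmorph0 horner0].
    rewrite (_ : x^-1 = x * (ev r) ^+ 2); first exact: Q'M.
    by rewrite rE -xs expr2 mulVKf.
  - move=> x y [s _ ->] [t _ ->].
    by have := Q'sq (s - t); rewrite rmorphB hornerD hornerN.
  - case=> s /nsos; rewrite -ev_eq0 rmorphD rmorph1 hornerD hornerC => /negP h e.
    by apply: h; rewrite -e subrr.
have QQ' x : Q x -> Q' x.
  move=> Qx; have [c cE] := v_onto (sub_differences Qmax.1 Qx).
  rewrite -cE in Qx *; exists (c%:P); last by rewrite map_polyC hornerC.
  have -> : c%:P = c *: 1 ^+ 2 by rewrite expr1n alg_polyC.
  by apply/weighted_sos1/vQ.
have Q'E x : Q' x -> differences Q x.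
  by move/(Qmax.2 Q' Q'pre QQ')/(sub_differences Qmax.1).
have alphaE : ev 'X = alpha by rewrite map_polyX hornerX.
have [_ EB EV] := differences_closed Qmax.1.
(* Squares from [L(alpha)] lie in [Q'], hence in [Q], and [alpha] is a quarter of a difference of
   two of them. *)
have Ealpha : differences Q alpha.
  have four : v 4%:R != 0 by rewrite fmorph_eq0 pnatr_eq0.
  have -> : alpha = ((alpha + 1) ^+ 2 - (alpha - 1) ^+ 2) / v 4%:R.
    by apply: (mulIf four); rewrite mulfVK // rmorph_nat; ring.
  apply: EV; last by apply/(sub_differences Qmax.1)/vQ/ler0n.
  apply: EB; apply: Q'E.
    by have := Q'sq ('X + 1); rewrite rmorphD rmorph1 hornerD hornerC alphaE.
  by have := Q'sq ('X - 1); rewrite rmorphB rmorph1 hornerD hornerN hornerC alphaE.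
have [x xE] := v_onto Ealpha; exists x.
by move: p_alpha; rewrite -xE fmorph_root.
Qed.

End RootAdjunction.

Variable Q : C -> Prop.
Hypothesis Qmax : maximal_preordered Q.
Hypothesis vQ : forall x, 0 <= x <-> Q (v x).
Hypothesis v_onto : forall z, differences Q z -> exists x, v x = z.

(** Induction on the degree. In a proper factorization one factor changes sign; an irreducible [p]
    is shown to have a root in [L], hence to be linear. *)
Lemma maximal_sign_change (p : {poly L}) (a b : L) :
  a <= b -> p.[a] * p.[b] < 0 -> exists2 x, a <= x <= b & root p x.
Proof.
move=> leab; have [n] := ubnP (size p); elim: n => // n IHn in p *; rewrite ltnS => sp pab.
have p0 : p != 0 by apply: contraTneq pab => ->; rewrite horner0 mul0r ltxx.
have [[q [r [pE sq sr]]]|nfact] := pselect (exists q r,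
    [/\ p = q * r, (size q < size p)%N & (size r < size p)%N]).
  have [qab|qab] := ltP (q.[a] * q.[b]) 0.
    have [x xab rx] := IHn q (leq_trans sq sp) qab.
    by exists x => //; rewrite pE rootM rx.
  have [rab|rab] := ltP (r.[a] * r.[b]) 0.
    have [x xab rx] := IHn r (leq_trans sr sp) rab.
    by exists x => //; rewrite pE rootM rx orbT.
  by move: pab; rewrite pE !hornerM mulrACA ltNge mulr_ge0.
have p_gt1 : (1 < size p)%N.
  rewrite ltnNge; apply: contraTN pab => /size1_polyC ->.
  by rewrite !hornerC -expr2 -leNgt sqr_ge0.
have p_irr : irreducible_poly p.
  split=> // q q1 qp; rewrite -dvdp_size_eqp // eqn_leq dvdp_leq //=.
  rewrite leqNgt; apply/negP => sq; apply: nfact.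
  have q0 : q != 0 by apply: contraNneq p0 => q0; move: qp; rewrite q0 dvd0p.
  exists q, (p %/ q); split=> //; first by rewrite mulrC divpK.
  have q2 : (1 < size q)%N by rewrite ltn_neqAle eq_sym q1 size_poly_gt0.
  rewrite size_divp //; move: q2 sq; move: (size q) (size p) => k m; lia.
have /closed_rootP[alpha p_alpha] : size (map_poly v p) != 1%N.
  by rewrite size_map_poly; case: (size p) p_gt1 => [|[]].
(* Otherwise [p * h = 1 + t] with [t] a reduced weighted sum of squares. The right side is positive
   everywhere, so [h] changes sign with [p]; by induction [h] has a root, where [1 + t] would
   vanish. *)
have [x rx] : exists x : L, root p x.
  apply: (root_of_maximal p_irr p_alpha Qmax) => // s hs; apply/negP => p1s.
  have [t [ht pst st]] := weighted_sos_mod p_gt1 hs.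
  have /dvdpP[h hE] : p %| 1 + t.
    have -> : 1 + t = 1 + s - (s - t) by ring.
    exact: dvdp_sub.
  have pos x : 0 < (1 + t).[x].
    by rewrite hornerD hornerC ltr_pwDl ?ltr01 ?weighted_sos_ge0.
  have hab : h.[a] * h.[b] < 0.
    have := mulr_gt0 (pos a) (pos b); rewrite hE !hornerM mulrACA.
    by rewrite nmulr_lgt0.
  have sh : (size h < n)%N.
    apply: leq_trans sp.
    have h0 : h != 0 by apply: contraTneq hab => ->; rewrite horner0 mul0r ltxx.
    have := size_mul h0 p0; rewrite -hE.
    have : (size (1 + t)%R <= maxn 1 (size t))%N.
      by apply: leq_trans (size_polyD _ _) _; rewrite size_poly1.
    move: st p_gt1; rewrite -addnn.
    by move: (size h) (size p) (size t) (size (1 + t)) => k m i j; lia.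
  have [x _ rx] := IHn h sh hab.
  by have := pos x; rewrite hE hornerM (eqP rx) mul0r ltxx.
have pE : p %= 'X - x%:P.
  rewrite eqp_sym; apply: p_irr.2; first by rewrite size_XsubC.
  by rewrite dvdp_XsubCl.
have /eqpf_eq[c c0 {}pE] := pE; exists x => //.
move: pab; rewrite pE !hornerZ !hornerXsubC mulrACA -expr2.
rewrite pmulr_rlt0 ?exprn_even_gt0 // => axb.
case: (leP a x) => ax; case: (leP x b) => xb //=.
- by move: axb; rewrite ltNge mulr_le0 // subr_le0 // ltW.
- by move: axb; rewrite ltNge mulr_ge0 // subr_ge0 ltW // (lt_le_trans ax).
- by have := lt_trans (le_lt_trans leab xb) ax; rewrite ltxx.
Qed.

Lemma maximal_real_closed : Num.real_closed_axiom L.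
Proof.
move=> p a b leab /andP[pa pb].
have [pa0|pa0] := eqVneq p.[a] 0; first by exists a; [rewrite lexx|apply/eqP].
have [pb0|pb0] := eqVneq p.[b] 0; first by exists b; [rewrite leab lexx|apply/eqP].
apply: maximal_sign_change => //.
by rewrite nmulr_rlt0 lt_def ?pb0 // eq_sym pa0.
Qed.

End RealClosed.

Section PreordFieldClosed.
Variables (C : closedFieldType) (Q : C -> Prop) (Qmax : maximal_preordered Q).

Fact preord_field_ivt : Num.real_closed_axiom (preord_field Qmax).
Proof.
apply: (maximal_real_closed (v := @preord_val C Q Qmax) Qmax).
  exact: preord_field_ge0.
by move=> z Ez; exists (to_subfield (differences_closed (proj1 Qmax)) Ez).
Qed.
HB.instance Definition _ :=
  Num.RealField_isClosed.Build (preord_field Qmax) preord_field_ivt.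

End PreordFieldClosed.

(** Zorn's lemma: each closure condition involves at most two elements, which lie in a common member
    of the chain. *)
Lemma maximal_preordered_exists (C : fieldType) (Q0 : C -> Prop) :
  preordered Q0 ->
  exists2 Q, maximal_preordered Q & forall x, Q0 x -> Q x.
Proof.
move=> Q0pre.
(* The empty set is admitted so that the empty chain has a union in [P]. *)
pose P (Q : C -> Prop) :=
  (exists x, Q x) -> preordered Q /\ forall x, Q0 x -> Q x.
have [F FP Ftot|Q [PQ Qmax]] := @classical_sets.Zorn_bigcup C P.
  have common x y : classical_sets.bigcup F id x -> classical_sets.bigcup F id y ->
      exists X, [/\ F X, X x & X y].
    move=> [X FX Xx] [Y FY Yy]; case: (Ftot X Y FX FY) => XY.
      by exists Y; split=> //; apply: XY.
    by exists X; split=> //; apply: XY.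
  have sub X x : F X -> X x -> classical_sets.bigcup F id x by move=> FX Xx; exists X.
  have pre X x : F X -> X x -> preordered X by move=> FX Xx; apply: (FP X FX _).1; exists x.
  case=> x0 [X0 FX0 X0x0]; split; last first.
    move=> x Q0x; apply: (sub X0 _ FX0).
    by apply: (FP X0 FX0 _).2 => //; exists x0.
  split.
  - exact: (sub X0 _ FX0 (preord1 (pre X0 x0 FX0 X0x0))).
  - move=> x y /common h /h[X [FX Xx Xy]].
    exact: (sub X _ FX (preordD (pre X x FX Xx) Xx Xy)).
  - move=> x y /common h /h[X [FX Xx Xy]].
    exact: (sub X _ FX (preordM (pre X x FX Xx) Xx Xy)).
  - move=> x [X FX Xx]; exact: (sub X _ FX (preordV (pre X x FX Xx) Xx)).
  - move=> x y /common h /h[X [FX Xx Xy]].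
    exact: (sub X _ FX (preord_sqrB (pre X x FX Xx) Xx Xy)).
  - case=> X FX XN1; exact: (preordN1 (pre X _ FX XN1) XN1).
have PQ0 : P Q0 by [].
have Qne : exists x, Q x.
  apply: contrapT => nQ; apply: (Qmax Q0) => //; split.
    by move=> x Qx; exfalso; apply: nQ; exists x.
  by move/(_ 1 (preord1 Q0pre)) => Q1; apply: nQ; exists 1.
have [Qpre Q0Q] := PQ Qne.
exists Q => //; split=> // Q' Q'pre QQ' x Q'x; apply: contrapT => nQx.
apply: (Qmax Q'); first by split=> // /(_ x Q'x).
by move=> _; split=> // y /Q0Q /QQ'.
Qed.

Lemma maximal_preordered_rcf (C : closedFieldType) (Q : C -> Prop) :
  maximal_preordered Q ->
  exists (L : rcfType) (v : {rmorphism L -> C}),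
    (forall x, 0 <= x <-> Q (v x)) /\
    (forall z, differences Q z -> exists x, v x = z).
Proof.
move=> Qmax; exists (preord_field Qmax), (@preord_val C Q Qmax); split.
  exact: preord_field_ge0.
by move=> z Ez; exists (to_subfield (differences_closed (proj1 Qmax)) Ez).
Qed.

(** Countability of [F] gives an algebraic closure [C], in which the image of [Q0] extends to a
    maximal [Q]. Every element of [F] is a difference of squares, so [F] lands in the real closed
    field of differences of [Q]. *)
Lemma real_closed_extension (F : countFieldType) (Q0 : F -> Prop) :
  preordered Q0 -> (forall x, Q0 (x ^+ 2)) ->
  exists (L : rcfType) (j : {rmorphism F -> L}), forall x, Q0 x -> 0 <= j x.
Proof.
move=> Q0pre Q0sq.
have [C [i _]] := countable_algebraic_closure F.
pose Qi z := exists2 x, Q0 x & z = i x.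
have Qi_pre : preordered Qi.
  split.
  - by exists 1; [apply: preord1 Q0pre|rewrite rmorph1].
  - move=> _ _ [x Qx ->] [y Qy ->]; exists (x + y); last by rewrite rmorphD.
    exact: (preordD Q0pre).
  - move=> _ _ [x Qx ->] [y Qy ->]; exists (x * y); last by rewrite rmorphM.
    exact: (preordM Q0pre).
  - move=> _ [x Qx ->]; exists x^-1; last by rewrite fmorphV.
    exact: (preordV Q0pre).
  - move=> _ _ [x Qx ->] [y Qy ->]; exists ((x - y) ^+ 2) => //.
    by rewrite rmorphXn rmorphB.
  - case=> x Qx e; apply: (preordN1 Q0pre).
    by rewrite (_ : -1 = x) //; apply: (fmorph_inj i); rewrite rmorphN1.
have [Q Qmax QiQ] := maximal_preordered_exists Qi_pre.
have QQ0 x : Q0 x -> Q (i x) by move=> Qx; apply: QiQ; exists x.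
have iE x : differences Q (i x).
  (* In characteristic 2 the element -1 equals the square 1. Otherwise [x] is the difference of the
     squares of [(x + 1) / 2] and [(x - 1) / 2]. *)
  have [n2|n2] := eqVneq (2%:R : F) 0.
    exfalso; apply: (preordN1 Q0pre).
    rewrite (_ : -1 = 1 ^+ 2 :> F) ?Q0sq // expr1n.
    by apply/eqP; rewrite eq_sym -addr_eq0; apply/eqP.
  exists (i ((x + 1) ^+ 2 / 2%:R ^+ 2)), (i ((x - 1) ^+ 2 / 2%:R ^+ 2)); split.
  - by rewrite -expr_div_n; apply: QQ0; apply: Q0sq.
  - by rewrite -expr_div_n; apply: QQ0; apply: Q0sq.
  - by rewrite -rmorphB; congr (i _); field;
      rewrite (_ : 4%:R = 2%:R * 2%:R :> F) ?mulf_neq0 // -natrM.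
have [L [v [vQ v_onto]]] := maximal_preordered_rcf Qmax.
have [j vj] : exists j : F -> L, forall x, v (j x) = i x.
  by exists (fun x => sval (cid (v_onto _ (iE x)))) => x; case: cid.
have jB : zmod_morphism j.
  by move=> x y; apply: (fmorph_inj v); rewrite rmorphB !vj rmorphB.
have jM : monoid_morphism j.
  split=> [|x y]; apply: (fmorph_inj v); first by rewrite vj !rmorph1.
  by rewrite rmorphM !vj rmorphM.
pose jA := GRing.isZmodMorphism.Build F L j jB.
pose jM' := GRing.isMonoidMorphism.Build F L j jM.
pose jR : {rmorphism F -> L} := HB.pack j jA jM'.
by exists L, jR => x Q0x; apply/vQ; rewrite /= vj; apply: QQ0.
Qed.

(** * Specialization of polynomial inequalities *)

Lemma mwiden_muniX (B : nzRingType) n (m : 'X_{1..n.+1}) :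
  mwiden 'X_[[multinom (m (widen_ord (leqnSn n) i)) | i < n]] * 'X_ord_max ^+ (m ord_max)
  = 'X_[m] :> {mpoly B[n.+1]}.
Proof.
rewrite mwidenX mpolyXn -mpolyXD; congr mpolyX; apply/mnmP => i.
rewrite mnmDE mulmnE mnmE.
case: (unliftP ord_max i) => [j ->|->].
  have -> : lift ord_max j = widen_ord (leqnSn n) j.
    by apply/val_inj; rewrite /= /bump leqNgt ltn_ord.
  rewrite mnmwiden_widen mnmE [_ == _](_ : _ = false) ?mul0n ?addn0 //.
  by apply/negbTE; rewrite -val_eqE /= gtn_eqF.
by rewrite mnmwiden_ordmax add0n eqxx mul1n.
Qed.

(** Singles out the last variable, the one that [elim_pos] eliminates. *)
Lemma rmorph_muni (B : comNzRingType) (S : comNzRingType) n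
    (f : {rmorphism {mpoly B[n.+1]} -> S}) (p : {mpoly B[n.+1]}) :
  f p = (map_poly (f \o @mwiden n B) (muni p)).[f 'X_ord_max].
Proof.
rewrite muniE {1}(mpolyE p) !rmorph_sum /= horner_sum; apply: eq_bigr => m _.
rewrite map_polyZ map_polyXn hornerZ hornerXn /= -rmorphXn -rmorphM.
by rewrite mwidenZ -scalerAl mwiden_muniX.
Qed.

Lemma mpoly_const0 (B : nzRingType) (p : {mpoly B[0]}) : p = (p@_0%MM)%:MP.
Proof.
apply/mpolyP => m; have -> : m = 0%MM by apply/mnmP; case.
by rewrite mcoeffC eqxx mulr1.
Qed.

Lemma mmap_mwiden (B : nzRingType) (S : comNzRingType) n (h : {rmorphism B -> S})
    (a : 'I_n.+1 -> S) (q : {mpoly B[n]}) :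
  mmap h a (mwiden q) = mmap h (fun i => a (widen_ord (leqnSn n) i)) q.
Proof.
suff sumE ms (c : 'X_{1..n} -> B) :
    mmap h a (mwiden (\sum_(m <- ms) c m *: 'X_[m])) =
    mmap h (fun i => a (widen_ord (leqnSn n) i)) (\sum_(m <- ms) c m *: 'X_[m]).
  by rewrite (mpolyE q) sumE.
rewrite (raddf_sum (@mwiden n B)) !rmorph_sum; apply: eq_bigr => m _.
rewrite -[LHS]/(mmap h a (mwiden (c m *: _))) -[RHS]/(mmap h _ (c m *: _)).
rewrite mwidenZ !mmapZ mwidenX !mmapX; congr (_ * _).
rewrite /mmap1 big_ord_recr /= mnmwiden_ordmax expr0 mulr1.
by apply: eq_bigr => i _; rewrite mnmwiden_widen.
Qed.

(** Induction on [n]: [elim_pos] turns the last variable into sign conditions on polynomials [C] in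
    the others. The induction hypothesis realizes these signs at a real point, and the solution
    [phi 'X_ord_max] in [L] then yields a real last coordinate. *)
Lemma specialize_mpoly (B : idomainType) (L R : rcfType) (h : {rmorphism B -> R})
    n (phi : {rmorphism {mpoly B[n]} -> L}) :
  injective phi -> (forall b, 0 < phi b%:MP -> 0 < h b) ->
  forall s : seq {mpoly B[n]}, all (fun p => 0 < phi p) s ->
  exists a : 'I_n -> R, all (fun p => 0 < mmap h a p) s.
Proof.
elim: n phi => [|n IHn] phi phi_inj phi_pos s s_pos.
  exists (fun _ => 0); apply/allP => p /(allP s_pos).
  by rewrite (mpoly_const0 p) mmapC; apply: phi_pos.
pose phi' : {rmorphism {mpoly B[n]} -> L} := phi \o @mwiden n B.
have phi'_inj : injective phi' by apply: inj_comp => //; apply: inj_mwiden.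
have sq0 : 0 \notin map (@muni n B) s.
  apply/negP => /mapP[p ps p0].
  by have := allP s_pos p ps; rewrite rmorph_muni -p0 rmorph0 horner0 ltxx.
have [C C0 HC] := elim_pos sq0.
have C_neq0 c : c \in C -> phi' c != 0.
  by move=> cC; rewrite raddf_eq0 //; apply: contraNneq C0 => <-.
(* Each [c] is replaced by whichever of [c], [- c] is positive in [L]; injectivity of [phi']
   excludes the value 0. *)
have [||a a_pos] := IHn phi' phi'_inj _ [seq if 0 < phi' c then c else - c | c <- C].
- by move=> b; rewrite /= mwidenC; apply: phi_pos.
- apply/allP => _ /mapP[c cC ->]; case: ifP => //; rewrite rmorphN oppr_gt0.
  by have := C_neq0 c cC; case: ltgtP.
have a_sign c : c \in C -> sgz (phi' c) = sgz (mmap h a c) /\ mmap h a c != 0.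
  move=> cC; have := allP a_pos _ (map_f _ cC).
  have := C_neq0 c cC; case: (ltgtP 0 (phi' c)) => // c_pos _.
    by move=> h0; rewrite !gtr0_sgz // gt_eqF.
  by rewrite rmorphN oppr_gt0 => h0; rewrite !ltr0_sgz // lt_eqF.
have [] := HC L R phi' (@mmap n B R h a).
- by apply/allP => c /C_neq0.
- by apply/allP => c /a_sign[].
- by apply/allP => c /a_sign[->].
- exists (phi 'X_ord_max); rewrite all_map; apply/allP => p /(allP s_pos).
  by rewrite /= rmorph_muni.
move=> t; rewrite all_map => t_pos.
exists (fun i => if unlift ord_max i is Some j then a j else t).
apply/allP => p ps; rewrite rmorph_muni; have := allP t_pos p ps.
rewrite /= mmapX mmap1U unlift_none; congr (0 < _.[_]); apply: eq_map_poly => q.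
rewrite [RHS]mmap_mwiden; congr (mmap h _ q).
apply: funext => i; have -> : widen_ord (leqnSn n) i = lift ord_max i.
  by apply/val_inj; rewrite /= /bump leqNgt ltn_ord.
by rewrite liftK.
Qed.

(** * The preordering of a place *)

Section Places.
Variables (K : fieldType) (emb : {rmorphism RR -> K}) (phi : K -> option RR).
Hypothesis phiP : is_Rplace emb phi.

Lemma place_const c : phi (emb c) = Some c.
Proof. by case: phiP. Qed.

Lemma place0 : phi 0 = Some 0.
Proof. by rewrite -(rmorph0 emb) place_const. Qed.

Lemma place1 : phi 1 = Some 1.
Proof. by rewrite -(rmorph1 emb) place_const. Qed.

Lemma placeD a b u v :
  phi a = Some u -> phi b = Some v -> phi (a + b) = Some (u + v).
Proof. by case: phiP => _ + _ _; apply. Qed.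

Lemma placeM a b u v :
  phi a = Some u -> phi b = Some v -> phi (a * b) = Some (u * v).
Proof. by case: phiP => _ _ + _; apply. Qed.

Lemma placeN a u : phi a = Some u -> phi (- a) = Some (- u).
Proof.
move=> au; rewrite -mulN1r -[- u]mulN1r.
by apply: placeM au; rewrite -(rmorphN1 emb) place_const.
Qed.

Lemma placeX a u k : phi a = Some u -> phi (a ^+ k) = Some (u ^+ k).
Proof.
move=> au; elim: k => [|k IH]; first by rewrite !expr0 place1.
by rewrite !exprS; apply: placeM.
Qed.

Lemma place_neq0 a u : phi a = Some u -> u != 0 -> a != 0.
Proof. by move=> au; apply: contra_neq => a0; move: au; rewrite a0 place0 => -[]. Qed.

Lemma placeV_infty a : a != 0 -> phi a = None <-> phi a^-1 = Some 0.
Proof. by case: phiP => _ _ _ + a0; apply. Qed.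

Lemma placeV a u : phi a = Some u -> u != 0 -> phi a^-1 = Some u^-1.
Proof.
move=> au u0; have a0 := place_neq0 au u0.
case aV: (phi a^-1) => [w|].
  have := placeM au aV; rewrite divff // place1 => -[uw].
  by congr Some; apply: (mulfI u0); rewrite divff.
have /(placeV_infty (invr_neq0 a0)) := aV; rewrite invrK au => -[u00].
by rewrite u00 eqxx in u0.
Qed.

Lemma place_sqr_finite a r : phi (a ^+ 2) = Some r -> exists u, phi a = Some u.
Proof.
move=> ar; case aE: (phi a) => [u|]; first by exists u.
have [a0|a0] := eqVneq a 0; first by rewrite a0 place0 in aE.
have /(placeV_infty a0) aV := aE.
have := placeM ar (placeX 2 aV); rewrite exprVn divff ?expf_neq0 // place1.
by rewrite expr0n mulr0 => -[/eqP]; rewrite oner_eq0.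
Qed.

(** The factor [g ^+ 2] admits elements [z] whose own value is 0 or infinite. *)
Definition place_cone (z : K) :=
  z = 0 \/ exists g r, [/\ g != 0, 0 < r & phi (z * g ^+ 2) = Some r].

Lemma place_cone_sqr x : place_cone (x ^+ 2).
Proof.
have [->|x0] := eqVneq x 0; first by left; rewrite expr0n.
right; exists x^-1, 1; split; rewrite ?invr_neq0 ?ltr01 //.
by rewrite -exprMn divff // expr1n place1.
Qed.

Lemma place_cone_preordered : preordered place_cone.
Proof.
split.
- by rewrite -[1](expr1n K 2); apply: place_cone_sqr.
- move=> x y [->|[g [r [g0 r0 gr]]]]; first by rewrite add0r.
  case=> [->|[h [s [h0 s0 hs]]]]; first by rewrite addr0; right; exists g, r.
  (* One of [g / h], [h / g] has a finite value, so by symmetry [g / h] does, say [c]; multiplying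
     [x + y] by [g ^+ 2] then gives the value [r + s * c ^+ 2]. *)
  wlog [c ghc] : x y g h r s g0 h0 r0 s0 gr hs / exists c, phi (g / h) = Some c.
    move=> IH; case ghE: (phi (g / h)) => [c|].
      by apply: (IH x y g h r s) => //; exists c.
    rewrite addrC; apply: (IH y x h g s r) => //; exists 0.
    by rewrite -[h / g]invf_div; apply/placeV_infty; rewrite ?mulf_neq0 ?invr_neq0.
  right; exists g, (r + s * c ^+ 2); split => //.
    by rewrite ltr_pwDl // mulr_ge0 ?sqr_ge0 // ltW.
  have -> : (x + y) * g ^+ 2 = x * g ^+ 2 + (y * h ^+ 2) * (g / h) ^+ 2 by field.
  by apply: placeD => //; apply: placeM => //; apply: placeX.
- move=> x y [->|[g [r [g0 r0 gr]]]]; first by rewrite mul0r; left.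
  case=> [->|[h [s [h0 s0 hs]]]]; first by rewrite mulr0; left.
  right; exists (g * h), (r * s); split; rewrite ?mulf_neq0 ?mulr_gt0 //.
  by rewrite exprMn mulrACA; apply: placeM.
- move=> x [->|[g [r [g0 r0 gr]]]]; first by rewrite invr0; left.
  have x0 : x != 0.
    by apply: contraTneq r0 => x0; move: gr; rewrite x0 mul0r place0 => -[<-]; rewrite ltxx.
  right; exists (x * g), r; split; rewrite ?mulf_neq0 //.
  by rewrite -gr; congr phi; field.
- by move=> x y _ _; apply: place_cone_sqr.
(* A finite value of [g ^+ 2] makes the value [u] of [g] finite, and [r = - u ^+ 2] cannot be
   positive. *)
- case=> [/eqP|[g [r [g0 r0]]]]; first by rewrite oppr_eq0 oner_eq0.
  rewrite mulN1r => gr; have := placeN gr; rewrite opprK => gr'.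
  have [u gu] := place_sqr_finite gr'; move: gr'; rewrite (placeX 2 gu) => -[/eqP].
  by rewrite eq_sym eqr_oppLR => /eqP rE; move: r0; rewrite rE oppr_gt0 ltNge sqr_ge0.
Qed.

End Places.

(** * Countable subfields and real points *)

Section CountableSubfield.
Variables (K : fieldType) (s : seq K).

(* Subtraction and division suffice, and terms are coded by [GenTree.tree nat]
   because that type is countable. *)
Fixpoint field_term_eval (t : GenTree.tree nat) : K :=
  match t with
  | GenTree.Leaf i => s`_i
  | GenTree.Node 0 [:: a; b] => field_term_eval a - field_term_eval b
  | GenTree.Node _ [:: a; b] => field_term_eval a / field_term_eval b
  | _ => 1
  end.

Definition generated_subfield (x : K) := exists t, field_term_eval t = x.

Lemma generated_subfield_closed : subfield_closed generated_subfield.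
Proof.
split; first by exists (GenTree.Node 0 [::]).
  by move=> x y [t <-] [u <-]; exists (GenTree.Node 0 [:: t; u]).
by move=> x y [t <-] [u <-]; exists (GenTree.Node 1 [:: t; u]).
Qed.

Lemma generated_subfield_mem x : x \in s -> generated_subfield x.
Proof. by move=> xs; exists (GenTree.Leaf (index x s)); rewrite /= nth_index. Qed.

Lemma generated_subfield_code :
  exists code : subfield generated_subfield_closed -> nat, injective code.
Proof.
exists (fun x => pickle (sval (cid (subfieldP x)))) => x y.
move/(pcan_inj pickleK); case: cid => t tx; case: cid => u uy /= tu.
by apply: val_inj; rewrite -tx -uy tu.
Qed.

End CountableSubfield.

(** The equality of field structures allows [real_closed_extension], stated for bundled countable
    fields, to be transported back to [F]. *)
Lemma countable_field (F : fieldType) (code : F -> nat) :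
  injective code -> exists Fc : countFieldType, Fc = F :> fieldType.
Proof.
move=> code_inj.
pose decode k : option F :=
  if pselect (exists x, code x = k) is left h then Some (sval (cid h)) else None.
have codeK : pcancel code decode.
  move=> x; rewrite /decode; case: pselect => [h|[]]; last by exists x.
  by case: cid => y /= /code_inj ->.
pose Fc : countFieldType := HB.pack F (Choice_isCountable.Build F codeK).
by exists Fc; destruct F as [T []].
Qed.

Lemma real_closed_extension_code (F : fieldType) (code : F -> nat) (Q0 : F -> Prop) :
  injective code -> preordered Q0 -> (forall x, Q0 (x ^+ 2)) ->
  exists (L : rcfType) (j : {rmorphism F -> L}), forall x, Q0 x -> 0 <= j x.
Proof.
move=> /countable_field[Fc FcE]; move: Q0; case: F / FcE code => _.
exact: real_closed_extension.
Qed.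

Lemma mpoly_rmorph_eq (B : nzRingType) (S : nzRingType) n
    (f g : {rmorphism {mpoly B[n]} -> S}) :
  (forall b, f b%:MP = g b%:MP) -> (forall i, f 'X_i = g 'X_i) -> f =1 g.
Proof.
move=> fgC fgX p; rewrite (mpolyE p) !rmorph_sum; apply: eq_bigr => m _.
rewrite -mul_mpolyC !rmorphM fgC mpolyXE_id !rmorph_prod; congr (_ * _).
by apply: eq_bigr => i _; rewrite !rmorphXn fgX.
Qed.

Lemma mpoly_lift (B R : nzRingType) (h : {rmorphism B -> R}) n (w : {mpoly R[n]}) :
  (forall m, exists b, h b = w@_m) -> exists p : {mpoly B[n]}, map_mpoly h p = w.
Proof.
move=> wB; exists (\sum_(m <- msupp w) sval (cid (wB m)) *: 'X_[m]).
rewrite [RHS]mpolyE (raddf_sum (map_mpoly h)); apply: eq_bigr => m _.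
by rewrite -[LHS]/(map_mpoly h (_ *: _)) map_mpolyZ map_mpolyX; case: cid => b /= ->.
Qed.

Lemma tofrac_inj (D : idomainType) : injective (@FracField.tofrac D).
Proof. by move=> x y /eqP; rewrite tofrac_eq => /eqP. Qed.

HB.instance Definition _ n := GRing.RMorphism.copy (@constN n)
  (@FracField.tofrac _ \o @mpolyC n RR).

Lemma rmorph_to_subfield (D : nzRingType) (K : fieldType) (S : K -> Prop)
    (Sc : subfield_closed S) (f : {rmorphism D -> K}) :
  (forall x, S (f x)) ->
  exists g : {rmorphism D -> subfield Sc}, forall x, \val (g x) = f x.
Proof.
move=> Sf; pose g x := to_subfield Sc (Sf x).
have gB : zmod_morphism g.
  by move=> x y; apply: val_inj; rewrite (raddfB (\val : subfield Sc -> K)) /= raddfB.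
have gM : monoid_morphism g.
  split=> [|x y]; apply: val_inj; first by rewrite (rmorph1 (\val : subfield Sc -> K)) /= rmorph1.
  by rewrite (rmorphM (\val : subfield Sc -> K)) /= rmorphM.
pose gA := GRing.isZmodMorphism.Build D (subfield Sc) g gB.
pose gM' := GRing.isMonoidMorphism.Build D (subfield Sc) g gM.
pose gR : {rmorphism D -> subfield Sc} := HB.pack g gA gM'.
by exists gR.
Qed.

Lemma place_real_point n (xi : RatFun n -> option RR) :
  is_Rplace (@constN n) xi ->
  forall ws : seq {mpoly RR[n]},
    (forall w, w \in ws -> w != 0 /\ place_cone xi w%:F) ->
  exists a : 'I_n -> RR, all (fun w => 0 < w.@[a]) ws.
Proof.
move=> xiP ws ws_cone.
pose gens : seq (RatFun n) :=
  [seq constN n w@_m | w <- ws, m <- msupp w] ++ [seq ('X_i)%:F | i <- enum 'I_n].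
pose S := generated_subfield gens.
pose Sc : subfield_closed S := generated_subfield_closed gens.
have [code code_inj] := generated_subfield_code gens.
have [S1 SB SV] := Sc.
have S0 : S 0 by rewrite -(subrr 1); apply: SB.
have SX i : S ('X_i)%:F.
  by apply: generated_subfield_mem; rewrite mem_cat (map_f (fun i => ('X_i)%:F)) ?orbT ?mem_enum.
have Scoef w m : w \in ws -> S (constN n w@_m).
  move=> ws_w; have [mw|mw] := boolP (m \in msupp w); last first.
    by rewrite memN_msupp_eq0 // rmorph0.
  apply: generated_subfield_mem; rewrite mem_cat; apply/orP; left.
  by apply: allpairs_f_dep.
(* The real constants lying in the countable field [F0] form a field [B] containing the coefficients
   of [ws], so that [ws] can be evaluated both in [F0] and in [RR]. *)
pose SR (c : RR) := S (constN n c).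
have SRc : subfield_closed SR.
  by split=> [|x y|x y]; rewrite /SR ?rmorph1 ?rmorphB ?fmorph_div //; [apply: SB|apply: SV].
pose B := subfield SRc; pose F0 := subfield Sc.
pose h : {rmorphism B -> RR} := \val; pose v : {rmorphism F0 -> RatFun n} := \val.
have [beta betaE] : exists beta : {rmorphism B -> F0}, forall b, v (beta b) = constN n (h b).
  apply: (@rmorph_to_subfield B _ _ Sc (@constN n \o h)) => b.
  exact: (subfieldP b).
pose x i : F0 := to_subfield Sc (SX i).
have vx i : v (x i) = ('X_i)%:F by [].
pose phi0 : {rmorphism {mpoly B[n]} -> F0} := mmap beta x.
have phi0E p : v (phi0 p) = (map_mpoly h p)%:F.
  apply: (@mpoly_rmorph_eq B _ n (v \o phi0) (@FracField.tofrac _ \o map_mpoly h)) => [b|i].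
    rewrite -[LHS]/(v (mmap beta x b%:MP)) mmapC betaE.
    by rewrite -[RHS]/((map_mpoly h b%:MP)%:F) map_mpolyC.
  rewrite -[LHS]/(v (mmap beta x 'X_i)) mmapX mmap1U vx.
  by rewrite -[RHS]/((map_mpoly h 'X_i)%:F) map_mpolyX.
have phi0_inj : injective phi0.
  move=> p q /(congr1 v); rewrite !phi0E => /tofrac_inj pq; apply/mpolyP => m.
  by apply: (fmorph_inj h); rewrite -!mcoeff_map_mpoly pq.
have cone_pre := place_cone_preordered xiP.
pose Q0 (z : F0) := place_cone xi (v z).
have Q0pre : preordered Q0.
  case: cone_pre => p1 pD pM pV pS pN.
  split; rewrite /Q0.
  - by rewrite rmorph1.
  - by move=> y z Qy Qz; rewrite rmorphD; apply: pD.
  - by move=> y z Qy Qz; rewrite rmorphM; apply: pM.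
  - by move=> y Qy; rewrite fmorphV; apply: pV.
  - by move=> y z Qy Qz; rewrite rmorphXn rmorphB; apply: pS.
  - by rewrite rmorphN1.
have Q0sq z : Q0 (z ^+ 2) by rewrite /Q0 rmorphXn; apply: (place_cone_sqr xiP).
have [L [j jQ]] : exists (L : rcfType) (j : {rmorphism F0 -> L}),
    forall z, Q0 z -> 0 <= j z.
  exact: real_closed_extension_code code_inj Q0pre Q0sq.
have jphi_inj : injective (j \o phi0) := inj_comp (@fmorph_inj _ _ j) phi0_inj.
have lift w : w \in ws -> exists p : {mpoly B[n]}, map_mpoly h p = w.
  move=> ws_w; apply: mpoly_lift => m.
  by exists (to_subfield SRc (Scoef w m ws_w)).
(* The place fixes constants, so the negative of a negative constant lies in the cone; hence the
   orders of [L] and [RR] agree on [B]. *)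
have phi_pos b : 0 < (j \o phi0) b%:MP -> 0 < h b.
  move=> jb; have b_neq0 : h b != 0.
    by rewrite fmorph_eq0; apply: contraTneq jb => ->; rewrite rmorph0 ltxx.
  rewrite lt_neqAle eq_sym b_neq0 leNgt; apply/negP => b_neg.
  have : 0 <= j (phi0 (- b)%:MP).
    apply: jQ; rewrite /Q0 phi0E map_mpolyC; right; exists 1, (- h b).
    split; rewrite ?oner_eq0 ?oppr_gt0 // expr1n mulr1 -(rmorphN h).
    exact: (place_const xiP (h (- b))).
  by rewrite mpolyCN !rmorphN oppr_ge0 leNgt jb.
pose ps := [seq (if pselect (w \in ws) is left H then sval (cid (lift w H)) else 0) | w <- ws].
have psE : map (map_mpoly h) ps = ws.
  rewrite -map_comp -[RHS]map_id; apply/eq_in_map => w ws_w /=.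
  by case: pselect => // H; case: cid.
have [|a a_pos] := specialize_mpoly jphi_inj phi_pos (s := ps).
  apply/allP => p pps /=.
  have [w_neq0 w_cone] : map_mpoly h p != 0 /\ place_cone xi (map_mpoly h p)%:F.
    by apply: ws_cone; rewrite -psE map_f.
  have jp : 0 <= j (phi0 p) by apply: jQ; rewrite /Q0 phi0E.
  rewrite lt_neqAle eq_sym jp andbT fmorph_eq0.
  by apply: contraNneq w_neq0 => p0; rewrite -tofrac_eq0 -phi0E (_ : phi0 p = 0) // rmorph0.
exists a; rewrite -psE all_map; apply/allP => p /(allP a_pos) /=.
have -> // : mmap h a p = (map_mpoly h p).@[a].
apply: (@mpoly_rmorph_eq B _ n (mmap h a) (@meval n RR a \o map_mpoly h)) => [b|i].
  by rewrite -[LHS]/(mmap h a b%:MP) mmapC -[RHS]/((map_mpoly h b%:MP).@[a]) map_mpolyC mevalC.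
rewrite -[LHS]/(mmap h a 'X_i) mmapX mmap1U.
by rewrite -[RHS]/((map_mpoly h 'X_i).@[a]) map_mpolyX mevalXU.
Qed.

(** * Places with a given centre *)

Lemma frac_reprE (D : idomainType) (x : {fraction D}) :
  x = (frac (repr x)).1%:F / (frac (repr x)).2%:F.
Proof.
have piM (r : {ratio D}) :
    FracField.mul (\pi_(FracField.type D) r)%qT (frac r).2%:F = (frac r).1%:F.
  rewrite !piE; apply/eqmodP.
  rewrite /= FracField.equivfE /FracField.mulf.
  by rewrite !numden_Ratio ?mulf_neq0 ?denom_ratioP ?oner_neq0 // !mulr1 mulrC.
apply: (mulIf (x := (frac (repr x)).2%:F)); first by rewrite tofrac_eq0 denom_ratioP.
by rewrite mulfVK ?tofrac_eq0 ?denom_ratioP // -[RHS]piM reprK.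
Qed.

Lemma fracP (D : idomainType) (x : {fraction D}) :
  exists p q, q != 0 /\ x = p%:F / q%:F.
Proof.
by exists (frac (repr x)).1, (frac (repr x)).2; rewrite denom_ratioP -frac_reprE.
Qed.

Lemma fraction_lift (D : idomainType) (K : fieldType) (f : {rmorphism D -> K}) :
  injective f -> exists g : {rmorphism {fraction D} -> K}, forall d, g d%:F = f d.
Proof.
move=> f_inj; have f0 d : d != 0 -> f d != 0 by rewrite raddf_eq0.
pose g (x : {fraction D}) := f (frac (repr x)).1 / f (frac (repr x)).2.
have gE p q : q != 0 -> g (p%:F / q%:F) = f p / f q.
  move=> q0; rewrite /g; move: (frac_reprE (p%:F / q%:F)).
  set r := repr _; have r0 := denom_ratioP r => e.
  apply/eqP; rewrite eqr_div ?f0 // -!rmorphM; apply/eqP; congr (f _).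
  apply/eqP; rewrite -tofrac_eq !tofracM -eqr_div ?tofrac_eq0 //.
  by rewrite e.
have gC d : g d%:F = f d.
  by rewrite -[d%:F]divr1 -tofrac1 gE ?oner_neq0 // rmorph1 divr1.
have gB : zmod_morphism g.
  move=> x y; have [p [q [q0 ->]]] := fracP x; have [p' [q' [q'0 ->]]] := fracP y.
  have -> : p%:F / q%:F - p'%:F / q'%:F = (p * q' - p' * q)%:F / (q * q')%:F.
    by rewrite tofracB !tofracM -mulNr addf_div ?tofrac_eq0 // mulNr.
  by rewrite !gE ?mulf_neq0 // rmorphB !rmorphM -[in RHS]mulNr addf_div ?f0 // mulNr.
have gM : monoid_morphism g.
  split=> [|x y]; first by rewrite -tofrac1 gC rmorph1.
  have [p [q [q0 ->]]] := fracP x; have [p' [q' [q'0 ->]]] := fracP y.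
  by rewrite mulf_div -!tofracM !gE ?mulf_neq0 // !rmorphM mulf_div.
pose gA := GRing.isZmodMorphism.Build {fraction D} K g gB.
pose gM' := GRing.isMonoidMorphism.Build {fraction D} K g gM.
pose gR : {rmorphism {fraction D} -> K} := HB.pack g gA gM'.
by exists gR.
Qed.

(** The quotient and the product differ by a nonzero square, which lets [p * q] carry the sign of
    [p / q]. *)
Lemma div_mulM_sqr (K : fieldType) (x y : K) : y != 0 -> x * y * y^-1 ^+ 2 = x / y.
Proof. by move=> y0; rewrite expr2 mulrA mulfK. Qed.

HB.instance Definition _ := GRing.RMorphism.copy const1
  (@FracField.tofrac _ \o @polyC RR).

Lemma fraction_poly_at (c : RR) (r : RatFun1) :
  exists p q, [/\ r = p%:F / q%:F, q != 0 & (p.[c] != 0) || (q.[c] != 0)].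
Proof.
have [p [q [q0 ->]]] := fracP r; pose g := gcdp p q.
have g0 : g != 0 by rewrite gcdp_eq0 negb_and q0 orbT.
have gp : p = (p %/ g) * g by rewrite divpK // dvdp_gcdl.
have gq : q = (q %/ g) * g by rewrite divpK // dvdp_gcdr.
have q'0 : q %/ g != 0 by apply: contraNneq q0 => e; rewrite gq e mul0r.
exists (p %/ g), (q %/ g); split => //.
  rewrite {1}gp {1}gq !tofracM invfM mulrACA divff ?mulr1 // ?tofrac_eq0 //.
have cop : coprimep (p %/ g) (q %/ g) by apply: coprimep_div_gcd; rewrite q0 orbT.
have [pc|//] := eqVneq (p %/ g).[c] 0.
by have := coprimep_root cop (introT eqP pc) => ->; rewrite ?orbT.
Qed.

Lemma place_poly (y : RatFun1 -> option RR) c : is_Rplace const1 y ->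
  y 'X%:F = Some c -> forall p : {poly RR}, y p%:F = Some p.[c].
Proof.
move=> yP yX; elim/poly_ind => [|p d IH]; first by rewrite tofrac0 horner0 (place0 yP).
rewrite tofracD tofracM hornerMXaddC; apply: (placeD yP); last exact: (place_const yP).
exact: (placeM yP).
Qed.

(** After cancelling the gcd, numerator and denominator do not both vanish at [c]. The value is then
    forced: the quotient of the values, or infinity because the inverse has value 0. *)
Lemma place_RatFun1_unique (y z : RatFun1 -> option RR) c :
  is_Rplace const1 y -> is_Rplace const1 z ->
  y 'X%:F = Some c -> z 'X%:F = Some c -> y = z.
Proof.
suff val y' (p q : {poly RR}) : is_Rplace const1 y' -> y' 'X%:F = Some c ->
    q != 0 -> (p.[c] != 0) || (q.[c] != 0) ->
    y' (p%:F / q%:F) = if q.[c] == 0 then None else Some (p.[c] / q.[c]).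
  move=> yP zP yX zX; apply: funext => r.
  by have [p [q [-> q0 pq]]] := fraction_poly_at c r; rewrite !val.
move=> yP yX q0; have yE := place_poly yP yX.
have [qc|qc] := eqVneq q.[c] 0 => [|_].
  rewrite orbF => pc; have p0 : p != 0 by apply: contraNneq pc => ->; rewrite horner0.
  apply/(placeV_infty yP); first by rewrite mulf_neq0 ?invr_neq0 ?tofrac_eq0.
  rewrite invf_div -[0 in RHS](mul0r p.[c]^-1) -qc.
  by apply: (placeM yP) => //; apply: (placeV yP).
by apply: (placeM yP) => //; apply: (placeV yP).
Qed.

(** Evaluation at [c], infinite at the poles. The value is chosen from some fraction with [q.[c] !=
    0]; [ev_place_some] shows that every such fraction gives the same one. *)
Definition ev_place (c : RR) (r : RatFun1) : option RR :=
  if pselect (exists v p q, [/\ r = p%:F / q%:F, q.[c] != 0 & v = p.[c] / q.[c]])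
  is left h then Some (sval (cid h)) else None.

Lemma ev_place_some c (p q : {poly RR}) :
  q.[c] != 0 -> ev_place c (p%:F / q%:F) = Some (p.[c] / q.[c]).
Proof.
move=> qc; rewrite /ev_place; case: pselect => [h|[]]; last first.
  by exists (p.[c] / q.[c]), p, q.
congr Some; case: cid => _ /= [p' [q' [e q'c ->]]].
have neq0 (r : {poly RR}) : r.[c] != 0 -> r%:F != 0.
  by rewrite tofrac_eq0; apply: contraNneq => ->; rewrite horner0.
apply/eqP; rewrite eqr_div // -!hornerM; apply/eqP; congr (_.[c]).
by apply/eqP; rewrite -tofrac_eq !tofracM -eqr_div ?neq0 // e.
Qed.

Lemma ev_place_someP c r v : ev_place c r = Some v ->
  exists p q, [/\ r = p%:F / q%:F, q.[c] != 0 & v = p.[c] / q.[c]].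
Proof. by rewrite /ev_place; case: pselect => // h [<-]; case: cid. Qed.

Lemma ev_placeP c : is_Rplace const1 (ev_place c).
Proof.
have evC d : ev_place c (const1 d) = Some d.
  have := @ev_place_some c d%:P 1; rewrite !hornerC oner_neq0 tofrac1 !divr1.
  by move=> ->.
have neq0 (r : {poly RR}) : r.[c] != 0 -> r%:F != 0.
  by rewrite tofrac_eq0; apply: contraNneq => ->; rewrite horner0.
have evM a b u v : ev_place c a = Some u -> ev_place c b = Some v ->
    ev_place c (a * b) = Some (u * v).
  move=> /ev_place_someP[p [q [-> qc ->]]] /ev_place_someP[p' [q' [-> q'c ->]]].
  by rewrite !mulf_div -!tofracM -!hornerM ev_place_some // hornerM mulf_neq0.
split=> //.
  move=> a b u v /ev_place_someP[p [q [-> qc ->]]] /ev_place_someP[p' [q' [-> q'c ->]]].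
  rewrite !addf_div ?neq0 // -!tofracM -tofracD -!hornerM -hornerD ev_place_some //.
  by rewrite hornerM mulf_neq0.
move=> r r0; split=> [rN|rV].
  have [p [q [rE q0 pq]]] := fraction_poly_at c r.
  have qc : q.[c] = 0.
    by apply/eqP; apply: contraPT rN => qc; rewrite rE ev_place_some.
  move: pq; rewrite qc eqxx orbF => pc.
  by rewrite rE invf_div ev_place_some // qc mul0r.
case rE: (ev_place c r) => [v|//].
have := evM _ _ _ _ rE rV; rewrite divff // -[1](rmorph1 const1) evC mulr0.
by move=> -[/eqP]; rewrite oner_eq0.
Qed.

Lemma ev_placeX c : ev_place c 'X%:F = Some c.
Proof.
have := @ev_place_some c 'X 1; rewrite hornerC hornerX oner_neq0 tofrac1 !divr1.
by move=> ->.
Qed.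

Section RationalFunctions.
Variable n : nat.
Implicit Types (xi : MN n) (a : 'I_n -> RR) (s : seq (RatFun n)).

Definition centered xi a := forall i, sval xi ('X_i)%:F = Some (a i).

Lemma centered_mpoly xi a (p : {mpoly RR[n]}) :
  centered xi a -> sval xi p%:F = Some p.@[a].
Proof.
have xiP := svalP xi => xiX.
have sum_E (ms : seq 'X_{1..n}) (c : 'X_{1..n} -> RR) :
    sval xi (\sum_(m <- ms) c m *: 'X_[m])%:F =
    Some (\sum_(m <- ms) c m * \prod_i a i ^+ m i).
  elim: ms => [|m ms IH]; first by rewrite !big_nil tofrac0 (place0 xiP).
  rewrite !big_cons tofracD; apply: (placeD xiP) => //.
  rewrite -mul_mpolyC tofracM; apply: (placeM xiP); first exact: (place_const xiP).
  rewrite mpolyXE_id; elim: (index_enum _) => [|i r IHr].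
    by rewrite !big_nil tofrac1 (place1 xiP).
  rewrite !big_cons tofracM; apply: (placeM xiP) => //.
  by rewrite tofracXn; apply: (placeX xiP).
by rewrite {1}(mpolyE p) sum_E mevalE.
Qed.

(** [place_real_point] is applied to the products of numerator and denominator. At the point [a] so
    found no denominator vanishes, so the value of each [f] at a place centred there is the positive
    number [f(a)]. *)
Lemma basic_center s : (exists xi : MN n, in_basic s xi) ->
  exists a, forall xi, centered xi a -> in_basic s xi.
Proof.
case=> xi s_xi; have xiP := svalP xi.
pose num (f : RatFun n) := (frac (repr f)).1.
pose den (f : RatFun n) := (frac (repr f)).2.
have den0 f : den f != 0 by exact: denom_ratioP.
have fE f : f = (num f)%:F / (den f)%:F by exact: frac_reprE.
have [w|a a_pos] := place_real_point xiP (ws := [seq num f * den f | f <- s]).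
  case/mapP=> f fs ->; have := allP s_xi f fs; rewrite /Hprime.
  case fv: (sval xi f) => [r|//] r0.
  have f0 : f != 0 by apply: (place_neq0 xiP fv); rewrite gt_eqF.
  split; first by rewrite mulf_neq0 //; apply: contraNneq f0 => e; rewrite (fE f) e tofrac0 mul0r.
  (* Multiplying [num f * den f] by the square of [1 / den f] gives back [f], whose value is [r]. *)
  right; exists (den f)%:F^-1, r; split; rewrite ?invr_neq0 ?tofrac_eq0 //.
  rewrite -fv; congr (sval xi _); rewrite [RHS](fE f) tofracM.
  have d0 : (den f)%:F != 0 by rewrite tofrac_eq0.
  exact: (div_mulM_sqr (num f)%:F d0).
exists a => zeta zeta_a; apply/allP => f fs; rewrite /Hprime.
have := allP a_pos _ (map_f _ fs); rewrite mevalM => pos.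
have qa0 : (den f).@[a] != 0 by apply: contraTneq pos => ->; rewrite mulr0 ltxx.
have zP := svalP zeta.
rewrite {1}(fE f) (placeM zP (centered_mpoly _ zeta_a) (placeV zP (centered_mpoly _ zeta_a) qa0)).
have -> : (num f).@[a] / (den f).@[a] = ((num f).@[a] * (den f).@[a]) * (den f).@[a]^-1 ^+ 2.
  by rewrite div_mulM_sqr.
by rewrite mulr_gt0 // exprn_even_gt0 // invr_eq0.
Qed.

(** Sending every variable to ['X] gives a left inverse. *)
Lemma poly_to_xi_inj (i : 'I_n) : injective (@poly_to_xi n i).
Proof.
have evP p (g : {rmorphism {mpoly RR[n]} -> {poly RR}}) :
    (forall c, g c%:MP = c%:P) -> g 'X_i = 'X -> g (poly_to_xi i p) = p.
  move=> gC gX; rewrite /poly_to_xi -horner_map gX -map_poly_comp.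
  rewrite (eq_map_poly (g := polyC)); last by move=> c; apply: gC.
  exact: comp_polyXr.
apply: (can_inj (g := mmap polyC (fun _ => 'X))) => p.
apply: (evP _ (mmap (@polyC RR) (fun _ => 'X))) => [c|]; first exact: mmapC.
by rewrite /= mmapX mmap1U.
Qed.

(** The fraction that [repr] picks for ['X] is unknown, but its numerator is ['X] times its
    denominator, and [poly_to_xi] preserves this relation. *)
Lemma emb_xiX (i : 'I_n) : emb_xi i 'X%:F = ('X_i)%:F.
Proof.
rewrite /emb_xi; set r := repr _; have r0 := denom_ratioP r.
have PM p q : poly_to_xi i (p * q) = poly_to_xi i p * poly_to_xi i q.
  by rewrite /poly_to_xi rmorphM hornerM.
have Pr0 : (poly_to_xi i (frac r).2)%:F != 0.
  rewrite tofrac_eq0; have <- : poly_to_xi i 0 = 0.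
    by rewrite /poly_to_xi rmorph0 horner0.
  by rewrite (inj_eq (@poly_to_xi_inj i)).
apply: (mulIf Pr0); rewrite mulfVK // -tofracM; congr (_%:F).
have -> : 'X_i = poly_to_xi i 'X by rewrite /poly_to_xi map_polyX hornerX.
rewrite -PM; congr poly_to_xi; apply/eqP; rewrite -tofrac_eq tofracM.
by rewrite {1}(frac_reprE 'X%:F) mulfVK ?tofrac_eq0.
Qed.

Variable iota : ('I_n -> M1) -> MN n.
Hypothesis iotaP : compatible_embedding iota.

Lemma compatibleX y i : sval (iota y) ('X_i)%:F = sval (y i) 'X%:F.
Proof. by rewrite -iotaP.2 /restr emb_xiX. Qed.

Definition ev_M1 (c : RR) : M1 := exist _ (ev_place c) (ev_placeP c).

Lemma centered_ev a : centered (iota (fun i => ev_M1 (a i))) a.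
Proof. by move=> i; rewrite compatibleX /= ev_placeX. Qed.

Lemma centered_image_unique a y z :
  centered (iota y) a -> centered (iota z) a -> iota y = iota z.
Proof.
move=> ya za; congr iota; apply: funext => i.
move: (ya i) (za i); rewrite !compatibleX.
case: (y i) (z i) => [u uP] [v vP] /= ui vi.
by apply: eq_exist; apply: place_RatFun1_unique uP vP ui vi.
Qed.

(* The substitution [x_i1 = a_i1 + (x_i2 - a_i2) x_i1] pulls the image place with
   centre [c] in direction [x_i1] and [a] in the others back to a place centred
   at [a] that sees the slope [c]. *)
Lemma centered_with_slope a (i1 i2 : 'I_n) (c : RR) : i1 != i2 ->
  exists zeta, centered zeta a /\
    sval zeta ((('X_i1 - (a i1)%:MP)%:F) / (('X_i2 - (a i2)%:MP)%:F)) = Some c.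
Proof.
move=> i12; have i21 : i2 == i1 = false by rewrite eq_sym; apply/negbTE.
pose sub i : {mpoly RR[n]} :=
  if i == i1 then (a i1)%:MP + ('X_i2 - (a i2)%:MP) * 'X_i1 else 'X_i.
pose sigma0 : {rmorphism {mpoly RR[n]} -> {mpoly RR[n]}} := mmap (@mpolyC n RR) sub.
have sigma0C d : sigma0 d%:MP = d%:MP by exact: mmapC.
have sigma0X i : sigma0 'X_i = sub i by rewrite /= mmapX mmap1U.
have den0 : ('X_i2 - (a i2)%:MP)%:F != 0 :> RatFun n.
  rewrite tofrac_eq0; apply/negP => /eqP/(congr1 (meval (fun _ => a i2 + 1))).
  rewrite mevalB mevalXU mevalC meval0 addrC addKr => /eqP.
  by rewrite oner_eq0.
(* The inverse substitution, which needs a denominator. [tau] undoes [sigma0], so [sigma0] is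
   injective and extends to the fraction field. *)
pose back i : RatFun n :=
  if i == i1 then ('X_i1 - (a i1)%:MP)%:F / ('X_i2 - (a i2)%:MP)%:F else ('X_i)%:F.
pose tau : {rmorphism {mpoly RR[n]} -> RatFun n} := mmap (@constN n) back.
have tauC d : tau d%:MP = (d%:MP)%:F by exact: mmapC.
have tauX i : tau 'X_i = back i by rewrite /= mmapX mmap1U.
have tauK p : tau (sigma0 p) = p%:F.
  apply: (@mpoly_rmorph_eq _ _ n (tau \o sigma0) (@FracField.tofrac _)) => [d|i].
    by rewrite -[LHS]/(tau (sigma0 _)) sigma0C tauC.
  rewrite -[LHS]/(tau (sigma0 _)) sigma0X /sub; case: eqVneq => [->|ni].
    rewrite rmorphD rmorphM rmorphB !tauC !tauX /back eqxx i21.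
    by rewrite -tofracB mulrC mulfVK // -tofracD addrC subrK.
  by rewrite tauX /back (negbTE ni).
have sigma0_inj : injective (@FracField.tofrac _ \o sigma0).
  by move=> p q /tofrac_inj /(congr1 tau); rewrite !tauK => /tofrac_inj.
have [sigma sigma_lift] := fraction_lift sigma0_inj.
have sigmaE p : sigma p%:F = (sigma0 p)%:F := sigma_lift p.
pose y i : M1 := ev_M1 (if i == i1 then c else a i).
have yP := svalP (iota y).
have zP : is_Rplace (@constN n) (sval (iota y) \o sigma).
  split=> /=.
  - by move=> d; rewrite sigmaE sigma0C; apply: (place_const yP).
  - by move=> p q u v pu qv; rewrite rmorphD; apply: (placeD yP).
  - by move=> p q u v pu qv; rewrite rmorphM; apply: (placeM yP).
  - by move=> p p0; rewrite fmorphV; apply: (placeV_infty yP); rewrite fmorph_eq0.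
have yX i : sval (iota y) ('X_i)%:F = Some (if i == i1 then c else a i).
  by rewrite compatibleX /= ev_placeX.
(* This value 0, together with the finite value [c] at ['X_i1], makes the product in [sub i1]
   vanish, so the new centre is [a]. *)
have y2 : sval (iota y) ('X_i2 - (a i2)%:MP)%:F = Some 0.
  rewrite tofracB -(subrr (a i2)); apply: (placeD yP); first by rewrite yX i21.
  exact: (placeN yP (place_const yP _)).
have y1 : sval (iota y) ('X_i1)%:F = Some c by rewrite yX eqxx.
exists (exist _ _ zP); split=> [i|] /=.
  rewrite sigmaE sigma0X /sub; case: eqVneq => [->|ni].
    rewrite tofracD tofracM -[a i1 in RHS]addr0 -(mul0r c).
    by apply: (placeD yP); [apply: (place_const yP)|apply: (placeM yP)].
  by rewrite yX (negbTE ni).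
(* Under [sigma] the difference quotient becomes ['X_i1], whose value is [c]. *)
rewrite fmorph_div !sigmaE !(rmorphB sigma0) !sigma0C !sigma0X.
rewrite /sub eqxx i21 addrAC subrr add0r tofracM mulrAC divff // mul1r.
exact: y1.
Qed.

End RationalFunctions.

(** * Density of the image and the places it misses *)

Theorem theorem7p3 (n : nat) (hn : (1 <= n)%N)
    (iota : ('I_n -> M1) -> MN n) :
  compatible_embedding iota ->
  (* the image of iota is dense: it meets every non-empty basic open set *)
  (forall s : seq (RatFun n), all (fun f => f != 0%R) s ->
     (exists xi : MN n, in_basic s xi) ->
     exists y : 'I_n -> M1, in_basic s (iota y))
  /\
  (* for n > 1, every non-empty basic open set contains infinitely many
     places outside the image of iota: no finite family exhausts them *)
  ((1 < n)%N ->
   forall s : seq (RatFun n), all (fun f => f != 0%R) s ->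
     (exists xi : MN n, in_basic s xi) ->
     forall (m : nat) (g : 'I_m -> MN n),
       exists xi : MN n,
         [/\ in_basic s xi,
             (forall y : 'I_n -> M1, sval (iota y) <> sval xi) &
             (forall k : 'I_m, sval (g k) <> sval xi)]).
Proof.
move=> iotaP; split=> [s _ /basic_center[a aP]|n1 s _ /basic_center[a aP] m g].
  by exists (fun i => ev_M1 (a i)); apply/aP/centered_ev.
pose i1 := Ordinal hn; pose i2 := Ordinal n1.
have slope c := centered_with_slope iotaP a c (isT : i1 != i2).
(* All [zeta c] are centred at [a], hence lie in the basic open set, and their slopes [c] tell them
   apart. *)
pose zeta (c : RR) := sval (cid (slope c)).
have zetaC c : centered (zeta c) a by rewrite /zeta; case: cid => z /= [].
have zeta_inj c d : sval (zeta c) = sval (zeta d) -> c = d.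
  rewrite /zeta; case: cid => z /= [_ zc]; case: cid => w /= [_ wd] zw.
  by move: wd; rewrite -zw zc => -[].
apply: contrapT => none.
(* Otherwise each [zeta c] lies in the image, which has one place centred at
   [a] only, or is some [g k]: at most [m + 1] places altogether. *)
have bad (c : 'I_m.+2) : exists o : option 'I_m,
    if o is Some k then sval (g k) = sval (zeta c%:R)
    else exists y, sval (iota y) = sval (zeta c%:R).
  apply: contrapT => nbad; apply: none; exists (zeta c%:R); split; first exact: aP.
    by move=> y yE; apply: nbad; exists None, y.
  by move=> k kE; apply: nbad; exists (Some k).
pose o c := sval (cid (bad c)).
have o_inj : injective o.
  move=> c d; rewrite /o; case: cid => oc /= cP; case: cid => od /= dP ocd.
  apply/val_inj/eqP; rewrite -(eqr_nat RR); apply/eqP/zeta_inj.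
  case: oc od cP dP ocd => [k|] [l|] //= cP dP; first by case=> kl; rewrite -cP -dP kl.
  move=> _; case: cP dP => y yE [z zE].
  have image_centered w e : sval (iota w) = sval (zeta e) -> centered (iota w) a.
    by move=> wE i; rewrite wE; apply: zetaC.
  rewrite -yE -zE; congr sval.
  exact: (centered_image_unique iotaP (image_centered _ _ yE) (image_centered _ _ zE)).
by have := leq_card o o_inj; rewrite card_option !card_ord ltnn.
Qed.
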